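(* Let $n>r\ge 3$ and $1\le t<2^r-r-1$ be integers. Suppose that $\mathcal F\subset 2^{[n]}$ is a non-trivial $r$-wise $t$-agreeing family with $|\mathcal F|=(r+t+1)2^{n-r-t}$. Then there exist a set $A\subset[n]$ with $|A|=r+t$ and a set $R\subset A$ such that $$\mathcal F=\{F\,\Delta\, R: F\subset[n],\ |F\cap A|\le 1\},$$ where $\Delta$ denotes symmetric difference.
   Context: $[n]=\{1,\ldots,n\}$. Sets $F_1,\ldots,F_r\subset[n]$ agree on a coordinate $x\in[n]$ if either $x\in\bigcap_{i\in[r]}F_i$ or $x\notin\bigcup_{i\in[r]}F_i$. A family $\mathcal F\subset 2^{[n]}$ is $r$-wise $t$-agreeing if any $r$ sets from $\mathcal F$ (not necessarily distinct) agree on at least $t$ coordinates. $\mathcal F$ is non-trivial if $\bigcap_{A\in\mathcal F}A=\emptyset$ and $\bigcup_{A\in\mathcal F}A=[n]$. *)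

(* Defs.v *)
From mathcomp Require Import all_boot.
Set Implicit Arguments. Unset Strict Implicit. Unset Printing Implicit Defensive.

Definition agree_on (n r : nat) (G : 'I_r -> {set 'I_n}) (x : 'I_n) : bool :=
  [forall i, x \in G i] || [forall i, x \notin G i].

Definition rwise_tagreeing (n r t : nat) (F : {set {set 'I_n}}) : Prop :=
  forall G : 'I_r -> {set 'I_n}, (forall i, G i \in F) ->
    t <= #|[set x | agree_on G x]|.

Definition nontrivial (n : nat) (F : {set {set 'I_n}}) : Prop :=
  \bigcap_(A in F) A = set0 /\ \bigcup_(A in F) A = setT.

Definition symdiff (n : nat) (A B : {set 'I_n}) : {set 'I_n} :=
  (A :\: B) :|: (B :\: A).

(* Main.v *)
Require Import Defs.
From mathcomp Require Import all_boot perm zify.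
Set Implicit Arguments. Unset Strict Implicit. Unset Printing Implicit Defensive.

(* Put N = r + t. Non-triviality makes F s-wise (N - s)-agreeing for every s in [2, r], and
   this property survives down-compressions and shifts. A family stable under all of
   them is a down-set D of 0-1 words whose 1s may be moved to the right, and agreement becomes
   the existence of common zeros.

   Write D0, D1 for the sections of D by the first letter. If D is r-wise T-intersecting in zeros
   (T > 0), then D0 is (T - 1)- and D1 is (T + r - 1)-intersecting. The bound
   |D| <= (N + 1) 2^(n - N), strict unless every word of D has at most one 1 among its first N
   letters, follows by induction as long as D1 has density at most 2^(1 - N). When it is denser,
   D contains a word with two early 1s, hence all pairs far enough to the right. For r >= 4 this
   makes D (r - 1)-wise (N + 2 - r)-intersecting, and the bound for r - 1 has room to spare;
   for r = 3 the gain comes from cross-intersecting triples of sections, whose densities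
   sum to at most 5/4 instead of 3/2.

   Finally, if a compression of F is a Hamming ball around R with respect to A, then the moved
   sets are all or none of the possible ones, because a kept set, a moved set and a third set would
   agree on too few coordinates; so F itself is such a ball. *)

Section Words.

Implicit Types (D E A B C W : pred (seq bool)) (u v w : seq bool).

(** * Words, common zeros and sections *)

Definition ones (w : seq bool) m := \sum_(i < m) nth false w i.

(** Below [w] in this order are the words obtained from it by deleting 1s and moving 1s to the
    right, so [shifted] expresses stability under both moves at once. *)
Definition prefix_le (v w : seq bool) :=
  size v = size w /\ forall m, ones v m <= ones w m.

Definition shifted n (D : pred (seq bool)) :=
  (forall w, D w -> size w = n) /\ (forall v w, prefix_le v w -> D w -> D v).

Definition zeros n (ws : seq (seq bool)) :=
  \sum_(i < n) all (fun w => ~~ nth false w i) ws.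

Definition wise n s k (D : pred (seq bool)) :=
  forall ws, size ws = s -> all D ws -> k <= zeros n ws.

Definition sec b (D : pred (seq bool)) : pred (seq bool) := fun w => D (b :: w).

(** Recursion on the first letter makes the splitting into the two sections hold by computation. *)
Fixpoint cnt n (D : pred (seq bool)) : nat :=
  if n is m.+1 then cnt m (sec false D) + cnt m (sec true D) else D [::].

Lemma ones_cons b w m : ones (b :: w) m.+1 = b + ones w m.
Proof. by rewrite /ones big_ord_recl. Qed.

Lemma ones0 w : ones w 0 = 0.
Proof. by rewrite /ones big_ord0. Qed.

Lemma prefix_le_cons b v w : prefix_le v w -> prefix_le (b :: v) (b :: w).
Proof.
move=> [svw H]; split; first by rewrite /= svw.
by case=> [|m]; rewrite ?ones0 // !ones_cons leq_add2l.
Qed.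

Lemma shifted_sec n b D : shifted n.+1 D -> shifted n (sec b D).
Proof.
move=> [sD cD]; split=> [w /sD [] //|v w vw]; exact/cD/prefix_le_cons.
Qed.

Lemma zeros_recl n ws :
  zeros n.+1 ws = all (fun w => ~~ nth false w 0) ws + zeros n (map behead ws).
Proof.
rewrite /zeros big_ord_recl; congr addn; apply: eq_bigr => i _.
by rewrite all_map; congr nat_of_bool; apply: eq_all => w /=; rewrite nth_behead.
Qed.

Lemma zeros_sub n ws us : {subset us <= ws} -> zeros n ws <= zeros n us.
Proof.
move=> sub; apply: leq_sum => i _; case: (boolP (all _ ws)) => //= /allP H.
by rewrite lt0b; apply/allP => w /sub /H.
Qed.

Lemma eq_zeros n ws us : ws =i us -> zeros n ws = zeros n us.
Proof.
by move=> E; apply/eqP; rewrite eqn_leq !zeros_sub // => w; rewrite E.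
Qed.

Lemma zerosE n ws :
  zeros n ws = #|[set i : 'I_n | all (fun w => ~~ nth false w i) ws]|.
Proof.
rewrite -sum1_card big_mkcond; apply: eq_bigr => i _; rewrite inE.
by case: (all _ _).
Qed.

Lemma zeros_gt0 n ws : 0 < zeros n ws ->
  exists i : 'I_n, all (fun w => ~~ nth false w i) ws.
Proof. by rewrite zerosE => /card_gt0P [i]; rewrite inE; exists i. Qed.

Lemma zeros_gt1 n ws : 1 < zeros n ws ->
  exists i j : 'I_n, [/\ i < j, all (fun w => ~~ nth false w i) ws
                              & all (fun w => ~~ nth false w j) ws].
Proof.
rewrite zerosE => /card_gt1P [i [j []]]; rewrite !inE => zi zj.
by rewrite neq_ltn => /orP [] ij; [exists i, j | exists j, i].
Qed.

Lemma map_behead_cons b (ws : seq (seq bool)) : map behead (map (cons b) ws) = ws.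
Proof. by rewrite -map_comp map_id_in. Qed.

Lemma wise_sec0 n s k D : wise n.+1 s k.+1 D -> wise n s k (sec false D).
Proof.
move=> H ws sws aD; have := H (map (cons false) ws); rewrite size_map all_map.
move=> /(_ sws aD); rewrite zeros_recl map_behead_cons all_map.
by rewrite (eq_all (a2 := predT)) // all_predT.
Qed.

Lemma prefix_le_flip i u : nth false u i = false ->
  i < size u -> prefix_le (false :: set_nth false u i true) (true :: u).
Proof.
move=> ui lt; split; first by rewrite /= size_set_nth; congr S; apply/maxn_idPr.
case=> [|m]; rewrite ?ones0 // !ones_cons add0n.
rewrite /ones; case: (ltnP i m) => im.
  rewrite (bigD1 (Ordinal im)) //= [X in _ <= _ + X](bigD1 (Ordinal im)) //= ui.
  rewrite nth_set_nth /= eqxx leq_add2l add0n; apply: leq_sum => j nj.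
  by rewrite nth_set_nth /=; case: eqP => // ji; case/eqP: nj; apply: val_inj.
apply: leq_trans (leq_addl _ _); apply: leq_sum => j _.
by rewrite nth_set_nth /=; case: eqP => // ji; have := ltn_ord j; lia.
Qed.

Lemma prefix_le_down u : prefix_le (false :: u) (true :: u).
Proof.
by split=> // -[|m]; rewrite ?ones0 // !ones_cons leq_add2r.
Qed.

Lemma zeros_flip n u vs (i : 'I_n) : all (fun w => ~~ nth false w i) (u :: vs) ->
  zeros n (set_nth false u i true :: vs) < zeros n (u :: vs).
Proof.
move=> zi; rewrite !zerosE; apply: proper_card; apply/properP; split.
  apply/subsetP => j; rewrite !inE /= nth_set_nth /=.
  by case: eqP => //= _ /andP [-> ->].
by exists i; rewrite inE ?zi //= nth_set_nth /= eqxx.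
Qed.

(* Trading the leading 1 of all words but one for a 1 at a common zero
   turns r words of the section into words of D with r - 1 fewer common zeros. *)
Lemma wise_sec1 n r T D : shifted n.+1 D -> 0 < r -> 0 < T ->
  wise n.+1 r T D -> wise n r (T + r.-1) (sec true D).
Proof.
move=> gD r0 T0 H.
(* [us] holds the words that still carry their leading 1, [vs] those that gave it up. *)
suff aux (us vs : seq (seq bool)) : us != [::] -> all (sec true D) us -> all (sec false D) vs ->
    size us + size vs = r -> T + (size us).-1 <= zeros n (us ++ vs).
  move=> ws sws aD; have nw : ws != [::] by rewrite -size_eq0 sws -lt0n.
  by have := aux ws [::] nw aD isT; rewrite cats0 addn0 sws; apply.
elim: us vs => [//|u us IH] vs _ /= /andP [Du Dus] Dvs sr.
have D0u : sec false D u by apply: gD.2 Du; apply: prefix_le_down.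
case: (eqVneq us [::]) => [us0|nus].
  rewrite us0 /= addn0.
  have := H ((true :: u) :: map (cons false) vs).
  rewrite /= size_map (Du : D (true :: u)) all_map => /(_ _ Dvs).
  rewrite zeros_recl /= map_behead_cons add0n; apply.
  by rewrite -sr us0.
have E z : zeros n (us ++ z :: vs) = zeros n (z :: us ++ vs).
  by apply: eq_zeros => x; rewrite !(inE, mem_cat) orbCA.
(* Merely deleting the leading 1 of [u] yields a common zero [i]; afterwards the 1 is put there
   instead, which destroys this zero. *)
have := IH (u :: vs) nus Dus; rewrite /= D0u => /(_ Dvs).
rewrite addnS -addSn sr => /(_ erefl) z1.
have : 0 < zeros n (u :: us ++ vs) by rewrite -E (leq_trans _ z1) ?ltn_addr.
case/zeros_gt0 => i zi.
have szu : size u = n by have := gD.1 _ Du; case.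
have := IH (set_nth false u i true :: vs) nus Dus; rewrite /= Dvs andbT.
have -> : sec false D (set_nth false u i true).
  apply: gD.2 Du; apply: prefix_le_flip; last by rewrite szu.
  by move: zi => /= /andP [/negbTE].
rewrite addnS -addSn sr => /(_ isT erefl).
rewrite E => z2; have -> : size us = (size us).-1.+1 by case: us nus {IH Dus sr E z1 zi z2}.
rewrite addnS; exact: leq_ltn_trans z2 (zeros_flip zi).
Qed.

(** For [a = b] this is a word with a single 1; a place from [n] on contributes no 1. *)
Definition pair_word n a b := mkseq (fun i => (i == a) || (i == b)) n.

Lemma size_pair_word n a b : size (pair_word n a b) = n.
Proof. by rewrite size_mkseq. Qed.

Lemma nth_pair_word n a b i :
  nth false (pair_word n a b) i = (i < n) && ((i == a) || (i == b)).
Proof.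
case: (ltnP i n) => ni; first by rewrite nth_mkseq.
by rewrite nth_default ?size_pair_word.
Qed.

Lemma sum_eq_ord a m : \sum_(i < m) (nat_of_ord i == a) = (a < m).
Proof.
case: (ltnP a m) => am.
  rewrite (bigD1 (Ordinal am)) //= eqxx big1 // => i ni.
  by case: eqP => // ia; case/eqP: ni; apply: val_inj.
by rewrite big1 // => i _; case: eqP => // ia; have := ltn_ord i; lia.
Qed.

Lemma ones_ge1 w p m : nth false w p -> (p < m) <= ones w m.
Proof.
move=> wp; rewrite -sum_eq_ord; apply: leq_sum => i _.
by case: eqP => // ->; rewrite wp.
Qed.

Lemma ones_ge2 w p q m : p < q -> nth false w p -> nth false w q ->
  (p < m) + (q < m) <= ones w m.
Proof.
move=> pq wp wq; rewrite -!sum_eq_ord -big_split; apply: leq_sum => i _ /=.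
case: (eqVneq (i : nat) p) => [->|_]; first by rewrite wp ltn_eqF.
by case: eqP => // ->; rewrite wq.
Qed.

Lemma ones_pair_word n a b m : ones (pair_word n a b) m <= (a < m) + (b < m).
Proof.
rewrite -!sum_eq_ord -big_split; apply: leq_sum => i _ /=.
by rewrite nth_pair_word; case: (i < n); case: (_ == a); case: (_ == b).
Qed.

Lemma ones_single_word n a m : ones (pair_word n a a) m <= (a < m).
Proof.
rewrite -!sum_eq_ord; apply: leq_sum => i _ /=.
by rewrite nth_pair_word orbb; case: (_ < _).
Qed.

Lemma prefix_le_single n w p a : size w = n -> nth false w p -> p <= a ->
  prefix_le (pair_word n a a) w.
Proof.
move=> sw wp pa; split=> [|m]; first by rewrite size_pair_word.
apply: leq_trans (ones_single_word _ _ _) _; apply: leq_trans (ones_ge1 m wp).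
have: a < m -> p < m by lia.
by case: (a < m); case: (p < m) => // /(_ isT).
Qed.

Lemma prefix_le_pair n w p q a b : size w = n -> nth false w p -> nth false w q ->
  p < q -> p <= a -> q <= b -> prefix_le (pair_word n a b) w.
Proof.
move=> sw wp wq pq pa qb; split=> [|m]; first by rewrite size_pair_word.
apply: leq_trans (ones_pair_word _ _ _ _) _; apply: leq_trans (ones_ge2 m pq wp wq).
apply: leq_add.
  have: a < m -> p < m by lia.
  by case: (a < m); case: (p < m) => // /(_ isT).
have: b < m -> q < m by lia.
by case: (b < m); case: (q < m) => // /(_ isT).
Qed.

Lemma cnt_le n D E : (forall w, size w = n -> D w -> E w) -> cnt n D <= cnt n E.
Proof.
elim: n D E => [|n IH] D E H /=; first by case: (D _) (H [::] erefl) => // ->.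
by apply: leq_add; apply: IH => w sw; apply: H; rewrite /= sw.
Qed.

Lemma cnt0 n D : (forall w, size w = n -> ~~ D w) -> cnt n D = 0.
Proof.
elim: n D => [|n IH] D H /=; first by rewrite (negbTE (H _ _)).
by rewrite !IH // => w sw; apply: H; rewrite /= sw.
Qed.

Lemma cnt_max n D : cnt n D <= 2 ^ n.
Proof.
elim: n D => [|n IH] D /=; first by case: (D _).
by rewrite expnS mul2n -addnn leq_add.
Qed.

Lemma cnt_full n D : cnt n D = 2 ^ n -> forall w, size w = n -> D w.
Proof.
elim: n D => [|n IH] D /=; first by case E : (D _) => // _ [].
rewrite expnS => E w; have [H0 H1] : cnt n (sec false D) = 2 ^ n /\ cnt n (sec true D) = 2 ^ n.
  by have := cnt_max n (sec false D); have := cnt_max n (sec true D); lia.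
by case: w => //= b w [sw]; case: b; [exact: (IH _ H1) | exact: (IH _ H0)].
Qed.

Lemma cnt_pos n D : 0 < cnt n D -> exists2 w, size w = n & D w.
Proof.
elim: n D => [|n IH] D /=; first by case E : (D _) => // _; exists [::].
by rewrite addn_gt0 => /orP [] /IH [w sw Dw];
  [exists (false :: w) | exists (true :: w)]; rewrite //= sw.
Qed.

(** A word of [A] is never the complement of a word of [B]. The induction pairs opposite sections,
    for which the first letter is no common zero. *)
Lemma cnt_cross2 n A B : (forall u v, size u = n -> size v = n -> A u -> B v -> 0 < zeros n [:: u; v]) ->
  cnt n A + cnt n B <= 2 ^ n.
Proof.
elim: n A B => [|n IH] A B H /=.
  have := H [::] [::] erefl erefl; rewrite /zeros big_ord0.
  by case: (A _) (B _) => [] [] // /(_ isT isT).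
have H01 : cnt n (sec false A) + cnt n (sec true B) <= 2 ^ n.
  apply: IH => u v su sv Au Bv.
  have := H (false :: u) (true :: v); rewrite /= su sv => /(_ erefl erefl Au Bv).
  by rewrite zeros_recl.
have H10 : cnt n (sec true A) + cnt n (sec false B) <= 2 ^ n.
  apply: IH => u v su sv Au Bv.
  have := H (true :: u) (false :: v); rewrite /= su sv => /(_ erefl erefl Au Bv).
  by rewrite zeros_recl.
rewrite expnS; lia.
Qed.

Lemma pair_wordS n a b : pair_word n.+1 a.+1 b.+1 = false :: pair_word n a b.
Proof.
apply: (@eq_from_nth _ false) => [|i _]; first by rewrite size_pair_word /= size_pair_word.
by rewrite nth_pair_word; case: i => // i; rewrite /= nth_pair_word.
Qed.

Lemma cnt_gt0 n D w : size w = n -> D w -> 0 < cnt n D.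
Proof.
move=> sw Dw; rewrite lt0n; apply/eqP.
elim: n D w sw Dw => [|n IH] D; first by case=> //= _ ->.
case=> //= b w [sw] Dw /eqP; rewrite addn_eq0 => /andP [/eqP H0 /eqP H1].
by case: b Dw => Dw; [exact: (IH (sec true D) w) | exact: (IH (sec false D) w)].
Qed.

(** * Cross-intersecting triples *)

Definition cross3 n A B C :=
  forall u v w, A u -> B v -> C w -> 0 < zeros n [:: u; v; w].

Lemma cross3_rot n A B C : cross3 n A B C -> cross3 n B C A.
Proof.
move=> H v w u Bv Cw Au; rewrite (@eq_zeros _ _ [:: u; v; w]) ?H // => x.
by rewrite !inE; case: (x == u); case: (x == v); case: (x == w).
Qed.

Lemma cross3_swap n A B C : cross3 n A B C -> cross3 n B A C.
Proof.
move=> H v u w Bv Au Cw; rewrite (@eq_zeros _ _ [:: u; v; w]) ?H // => x.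
by rewrite !inE; case: (x == u); case: (x == v); case: (x == w).
Qed.

Lemma cross3_sec n a b c A B C : a || b || c -> cross3 n.+1 A B C ->
  cross3 n (sec a A) (sec b B) (sec c C).
Proof.
move=> abc H u v w Au Bv Cw; have := H _ _ _ Au Bv Cw.
by rewrite zeros_recl /=; move: abc; case: a Au; case: b Bv; case: c Cw.
Qed.

Lemma cross3_cnt2 n A B C : cross3 n A B C -> 0 < cnt n C ->
  cnt n A + cnt n B <= 2 ^ n.
Proof.
move=> H /cnt_pos [w sw Cw]; apply: cnt_cross2 => u v su sv Au Bv.
apply: leq_trans (H _ _ _ Au Bv Cw) _; apply: zeros_sub => x.
by rewrite !inE orbA => ->.
Qed.

Lemma cnt_sec1_le0 n D : shifted n.+1 D -> cnt n (sec true D) <= cnt n (sec false D).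
Proof. by move=> gD; apply: cnt_le => w sw; apply: gD.2; apply: prefix_le_down. Qed.

Lemma sec0_ge n D : shifted n.+1 D -> 0 < cnt n.+1 D -> 0 < cnt n (sec false D).
Proof. by move=> gD /=; have := cnt_sec1_le0 gD; lia. Qed.

(** In units of [2^n]: [A0] and [B1] together count at most 1; so does each of the three pairs among
    [A1], [B0], [C0], hence these three at most 3/2. As [C1] is empty, the total is at most 5/2. *)
Lemma cross3_aux n A B C : shifted n.+1 A -> shifted n.+1 B -> shifted n.+1 C ->
  cross3 n.+1 A B C -> 0 < cnt n.+1 A -> 0 < cnt n.+1 B -> 0 < cnt n.+1 C ->
  0 < cnt n (sec true A) -> cnt n (sec true C) = 0 ->
  4 * (cnt n.+1 A + cnt n.+1 B + cnt n.+1 C) <= 5 * 2 ^ n.+1.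
Proof.
move=> gA gB gC H A0 B0 C0 A1 C1.
have B00 := sec0_ge gB B0; have C00 := sec0_ge gC C0.
have h1 := cross3_sec (a := true) (b := false) (c := false) isT H.
have h2 := cross3_sec (a := false) (b := true) (c := false) isT H.
have e1 := cross3_cnt2 h2 C00.
have e2 := cross3_cnt2 h1 C00.
have e3 := cross3_cnt2 (cross3_rot h1) A1.
have e4 := cross3_cnt2 (cross3_rot (cross3_rot h1)) B00.
rewrite /= C1 expnS; lia.
Qed.

(** A leading 1 moves to the second letter. This preserves the nonemptiness hypothesis in the
    induction for [cross3_bound]. *)
Lemma has_next n D : shifted n.+2 D -> 0 < cnt n.+1 (sec true D) ->
  0 < cnt n (sec true (sec false D)).
Proof.
move=> gD /cnt_pos [w sw Dw].
apply: (@cnt_gt0 _ _ (behead (pair_word n.+1 0 0))).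
  by rewrite size_behead size_pair_word.
have -> : sec true (sec false D) (behead (pair_word n.+1 0 0)) = D (pair_word n.+2 1 1).
  by rewrite pair_wordS.
by apply: (gD.2 _ _ _ Dw); apply: (@prefix_le_single _ _ 0); rewrite //= sw.
Qed.

(** Up to a permutation of the triple, [cross3_aux] settles every case in which some but not all of
    the sections by 1 are empty. *)
Lemma cross3_cases n A B C : shifted n.+1 A -> shifted n.+1 B -> shifted n.+1 C ->
  cross3 n.+1 A B C -> 0 < cnt n.+1 A -> 0 < cnt n.+1 B -> 0 < cnt n.+1 C ->
  0 < cnt n (sec true A) + cnt n (sec true B) + cnt n (sec true C) ->
  (0 < cnt n (sec true A) -> 0 < cnt n (sec true B) -> 0 < cnt n (sec true C) ->
    4 * (cnt n.+1 A + cnt n.+1 B + cnt n.+1 C) <= 5 * 2 ^ n.+1) ->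
  4 * (cnt n.+1 A + cnt n.+1 B + cnt n.+1 C) <= 5 * 2 ^ n.+1.
Proof.
move=> gA gB gC H A0 B0 C0 h K.
have [zA|pA] := posnP (cnt n (sec true A));
  have [zB|pB] := posnP (cnt n (sec true B));
  have [zC|pC] := posnP (cnt n (sec true C)).
- by move: h; rewrite zA zB zC.
- by have := cross3_aux gC gB gA (cross3_swap (cross3_rot H)) C0 B0 A0 pC zA; lia.
- by have := cross3_aux gB gA gC (cross3_swap H) B0 A0 C0 pB zC; lia.
- by have := cross3_aux gB gC gA (cross3_rot H) B0 C0 A0 pB zA; lia.
- by have := cross3_aux gA gB gC H A0 B0 C0 pA zC.
- by have := cross3_aux gA gC gB (cross3_rot (cross3_swap H)) A0 C0 B0 pA zB; lia.
- by have := cross3_aux gA gB gC H A0 B0 C0 pA zC.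
- exact: K.
Qed.

(* The triples (A1, B0, C0) and (A0, B1, C1) of sections are again cross-intersecting. *)
Lemma cross3_bound n A B C : shifted n.+1 A -> shifted n.+1 B -> shifted n.+1 C ->
  cross3 n.+1 A B C -> 0 < cnt n.+1 A -> 0 < cnt n.+1 B -> 0 < cnt n.+1 C ->
  0 < cnt n (sec true A) + cnt n (sec true B) + cnt n (sec true C) ->
  4 * (cnt n.+1 A + cnt n.+1 B + cnt n.+1 C) <= 5 * 2 ^ n.+1.
Proof.
elim: n A B C => [|n IH] A B C gA gB gC H A0 B0 C0 h;
  apply: cross3_cases => // pA pB pC.
  have h1 := cross3_sec (a := true) (b := false) (c := false) isT H.
  case/cnt_pos: pA => a /size0nil -> Aa.
  case/cnt_pos: (sec0_ge gB B0) => b /size0nil -> Bb.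
  case/cnt_pos: (sec0_ge gC C0) => c /size0nil -> Cc.
  by have := h1 _ _ _ Aa Bb Cc; rewrite /zeros big_ord0.
have h1 := cross3_sec (a := true) (b := false) (c := false) isT H.
have h2 := cross3_sec (a := false) (b := true) (c := true) isT H.
have := IH _ _ _ (shifted_sec _ gA) (shifted_sec _ gB) (shifted_sec _ gC) h1 pA
  (sec0_ge gB B0) (sec0_ge gC C0).
have := IH _ _ _ (shifted_sec _ gA) (shifted_sec _ gB) (shifted_sec _ gC) h2
  (sec0_ge gA A0) pB pC.
have := has_next gA pA; have := has_next gB pB; rewrite (expnS 2 n.+1) => hB hA.
move=> i1 i2; have := i1 (ltn_addr _ (ltn_addr _ hA)).
have := i2 (ltn_addr _ (ltn_addl _ hB)).
have E D : cnt n.+2 D = cnt n.+1 (sec false D) + cnt n.+1 (sec true D) by [].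
rewrite !E; lia.
Qed.

(** * The size of graded shifted families *)

Definition graded r N n D := forall s, 1 < s <= r -> wise n s (N - s) D.

Lemma zeros_le n ws : zeros n ws <= n.
Proof. by rewrite zerosE (leq_trans (max_card _)) ?card_ord. Qed.

Lemma wise_leq n s k D w : wise n s k D -> D w -> k <= n.
Proof.
move=> H Dw; apply: leq_trans (H (nseq s w) _ _) (zeros_le _ _).
  by rewrite size_nseq.
by rewrite all_nseq Dw orbT.
Qed.

Lemma graded_sec0 r N n D : r <= N -> graded r N.+1 n.+1 D -> graded r N n (sec false D).
Proof.
move=> rN H s sr; apply: wise_sec0; have := H s sr; rewrite subSn //.
by apply: leq_trans rN; case/andP: sr.
Qed.

Lemma graded_sec1 r N n D : 1 < r <= N -> shifted n.+1 D -> graded r N.+1 n.+1 D ->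
  wise n r N (sec true D).
Proof.
move=> /andP [r1 rN] gD H; have := H r; rewrite r1 leqnn => /(_ isT) H'.
have -> : N = N.+1 - r + r.-1 by lia.
by apply: wise_sec1 => //; lia.
Qed.

(** A word with leading 1 brings every word with a single 1 into [D]. Adding the one whose 1 sits at
    a common zero of [s] words destroys that zero, so each step from [s + 1] down to [s] gains one
    common zero. *)
Lemma wise_graded r T n D w : shifted n D -> 0 < T -> wise n r T D ->
  D w -> nth false w 0 -> graded r (T + r) n D.
Proof.
move=> gD T0 H Dw w0.
suff aux j s : 0 < s -> s + j = r -> wise n s (T + j) D.
  move=> s /andP [s1 sr]; have -> : T + r - s = T + (r - s) by lia.
  by apply: aux; lia.
elim: j s => [|j IH] s s0 sr.
  by move=> ws sws aD; rewrite addn0; apply: H; lia.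
move=> ws sws aD; case: ws sws aD => [|u ws sws aD]; first by move=> /= sws; lia.
have {}IH : wise n s.+1 (T + j) D by apply: IH; lia.
have h0 : T + j <= zeros n (u :: ws).
  rewrite (@eq_zeros _ _ (u :: u :: ws)); first last.
    by move=> x; rewrite !inE orbA orbb.
  apply: IH; first by rewrite -sws.
  by move: aD => /= /andP [-> ->].
have /zeros_gt0 [i zi] : 0 < zeros n (u :: ws) by lia.
have Di : D (pair_word n i i).
  by apply: (gD.2 _ _ _ Dw); apply: (prefix_le_single (p := 0)) => //; apply: gD.1.
have {}h0 : T + j <= zeros n (pair_word n i i :: u :: ws).
  by apply: IH; [rewrite -sws | rewrite /= Di].
rewrite addnS; apply: leq_ltn_trans h0 _; rewrite !zerosE.
apply: proper_card; apply/properP; split.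
  by apply/subsetP => x; rewrite !inE /= => /andP [].
by exists i; rewrite inE //= nth_pair_word ltn_ord eqxx.
Qed.

Lemma zeros_pair_word n ws (i j : 'I_n) : i < j ->
  all (fun w => ~~ nth false w i) ws -> all (fun w => ~~ nth false w j) ws ->
  zeros n (pair_word n i j :: ws) + 2 <= zeros n ws.
Proof.
move=> ij zi zj; rewrite !zerosE (cardsD1 i [set x : 'I_n | all _ ws]).
rewrite (cardsD1 j (_ :\ i)) !inE zi zj /=.
have -> : j != i by rewrite neq_ltn ij orbT.
rewrite addnA addnC leq_add2l; apply: subset_leq_card; apply/subsetP => x.
by rewrite !inE /= nth_pair_word ltn_ord negb_or -!val_eqE /= => /andP [/andP [-> ->] ->].
Qed.

(** Now every word with two 1s is in [D]. Adding the one that occupies two common zeros of [s] words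
    destroys both, and [N - (s + 1) + 2 = N + 1 - s]. *)
Lemma graded_pair r N n D w : r.+2 <= N -> shifted n D -> graded r.+1 N n D ->
  D w -> nth false w 0 -> nth false w 1 -> graded r N.+1 n D.
Proof.
move=> rN gD H Dw w0 w1 s /andP [s1 sr] ws sws aD.
have h0 : N - s <= zeros n ws by apply: H => //; lia.
have /zeros_gt1 [i [j [ij zi zj]]] : 1 < zeros n ws by lia.
have Dij : D (pair_word n i j).
  apply: (gD.2 _ _ _ Dw); apply: (prefix_le_pair (p := 0) (q := 1)) => //; first exact: gD.1.
  by lia.
have {}h0 : N - s.+1 <= zeros n (pair_word n i j :: ws).
  by apply: H; rewrite /= ?sws ?Dij //; lia.
by have := zeros_pair_word ij zi zj; lia.
Qed.

(** The largest [t] that the theorem admits. *)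
Definition critical r := 2 ^ r - r - 2.

(** Each of [j] leading letters that vanish throughout [D] raises the admissible [T] by one. The
    word forced by equality is what later refutes equality in [graded_bound]. *)
Definition below_critical r n := forall j T D, shifted n D -> wise n r T D ->
  T <= critical r + j -> (forall w i, D w -> i < j -> nth false w i = false) ->
  cnt n D * 2 ^ T <= 2 ^ n /\
  (cnt n D * 2 ^ T = 2 ^ n -> D (nseq T false ++ nseq (n - T) true)).

(* Beyond the critical value the density bound 2^-T loses a factor 1 + 1/q per unit, where
   q = 2^(r-1): the constant c = (1 + 1/q) / 2 satisfies c^r + 1 <= 2 c, which is what the
   recursion over D0 and D1 needs. *)
Definition above_critical r n := forall j D, shifted n D ->
  wise n r (critical r + j) D ->
  cnt n D * 2 ^ (critical r + j) * (2 ^ r.-1) ^ j <= (2 ^ r.-1).+1 ^ j * 2 ^ n.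

(** The pair word in the strict part lies below every word with two 1s among the first [N] letters,
    so strictness fails only if no such word exists. *)
Definition graded_bound r n := forall N D, shifted n D -> graded r N n D ->
  r <= N <= 2 ^ r - 2 ->
  cnt n D * 2 ^ N <= N.+1 * 2 ^ n /\
  (r < N <= n -> D (pair_word n (N - 2) (N - 1)) -> cnt n D * 2 ^ N < N.+1 * 2 ^ n).

(** The case that escapes the recursion over sections: two early 1s, so that [below_critical] does
    not cover the section by 1. *)
Definition pair_bound r n := forall N D w p, shifted n D -> graded r N n D ->
  critical r + 2 <= N <= 2 ^ r - 2 ->
  0 < p < r -> D w -> nth false w 0 -> nth false w p ->
  cnt n D * 2 ^ N < N.+1 * 2 ^ n.

Lemma expr_large r : 3 <= r -> r.+1 <= 2 ^ r.-1 /\ 2 ^ r = 2 * 2 ^ r.-1.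
Proof.
move=> r3; have e : 2 ^ r = 2 * 2 ^ r.-1 by rewrite -expnS prednK //; lia.
split=> // {e}; have -> : r = (r - 3).+3 by lia.
elim: (r - 3) => // k; rewrite /= !expnS; lia.
Qed.

Lemma wise0 s k D : 0 < k -> wise 0 s k D -> cnt 0 D = 0.
Proof.
by move=> k0 H /=; case E : (D [::]) => //; have := wise_leq H E; lia.
Qed.

Lemma below_critical0 r : below_critical r 0.
Proof.
move=> j [|T] D gD H _ _; rewrite /= ?subn0; last by have /= -> := wise0 _ H.
by case: (D _).
Qed.

Lemma graded_bound0 r : 3 <= r -> graded_bound r 0.
Proof.
move=> r3 N D gD H rN.
have h : wise 0 2 (N - 2) D by apply: H; lia.
have -> := wise0 _ h; last by lia.
by rewrite mul0n expn0 muln1.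
Qed.

Lemma above_critical0 r : 3 <= r -> above_critical r 0.
Proof.
move=> r3 j D gD H; have [] := expr_large r3 => e1 e2.
have -> := wise0 _ H; last by rewrite /critical; lia.
by [].
Qed.

(** In units of [2^(n + 1 - N)], the section by 0 contributes at most [N] by the bound for [N - 1],
    and the section by 1 at most one more if [below_critical] applies to it. *)
Lemma graded_bound_step r n :
  3 <= r -> below_critical r n -> graded_bound r n -> pair_bound r n.+1 ->
  (forall D, shifted n.+1 D -> graded r r n.+1 D -> cnt n.+1 D * 2 ^ r <= r.+1 * 2 ^ n.+1) ->
  graded_bound r n.+1.
Proof.
move=> r3 Hb Hg Hp H0 N D gD gr; have [e1 e2] := expr_large r3.
rewrite leq_eqVlt => /andP [/orP [/eqP rE _|]].
  by subst N; rewrite ltnn; split=> //; apply: H0.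
case: N gr => // N gr; rewrite ltnS => rN Nr.
have g0 := graded_sec0 rN gr.
have g1 : wise n r N (sec true D) by apply: graded_sec1 => //; lia.
have rN' : r <= N <= 2 ^ r - 2 by lia.
have [b0 _] := Hg N _ (shifted_sec _ gD) g0 rN'.
(* If no word of the section has a 1 among these letters, they serve as the [j] vanishing letters of
   [below_critical]; any such word leads to [pair_bound]. *)
pose E w := sec true D w && has id (take (N - critical r) w).
have [zE|/cnt_pos [w sw /andP [Dw]]] := posnP (cnt n E); last first.
  move=> /(has_nthP false) [i]; rewrite size_take => i1.
  have i2 : i < N - critical r by move: i1; case: ifP; lia.
  rewrite nth_take // => wi.
  suff lt : cnt n.+1 D * 2 ^ N.+1 < N.+2 * 2 ^ n.+1.
    by split=> [|_ _ //]; apply: ltnW.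
  by apply: (Hp _ _ (true :: w) i.+1) => //; rewrite /critical in i2 *; lia.
have [] := Hb (N - critical r) N _ (shifted_sec true gD) g1.
- lia.
- move=> w i Dw lt; apply/negbTE/negP => wi.
  suff : 0 < cnt n E by rewrite zE.
  have sw : size w = n by have := gD.1 _ Dw; case.
  apply: (@cnt_gt0 _ _ w) => //; rewrite /E Dw; apply/(has_nthP false); exists i.
    rewrite size_take; case: ifP => // _; rewrite ltnNge; apply/negP => h.
    by rewrite nth_default in wi.
  by rewrite nth_take.
move=> b1 eq1; split=> [|/andP [_ Nn] Dp]; first by rewrite /= !expnS; lia.
suff : cnt n (sec true D) * 2 ^ N != 2 ^ n by rewrite /= !expnS; lia.
apply/eqP => /eq1 Dw.
have r1 : 1 < r <= r by lia.
have := gr r r1.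
(* Equality puts 1, [N] zeros, then ones into [D]. With the pair word and the single 1s at
   [1, ..., r - 2], common zeros remain only at [r - 1, ..., N - 2]: one fewer than required. *)
pose sing := [seq pair_word n.+1 i i | i <- iota 1 (r - 2)].
move=> /(_ (pair_word n.+1 (N.+1 - 2) (N.+1 - 1) ::
   (true :: nseq N false ++ nseq (n - N) true) :: sing)).
rewrite /= size_map size_iota Dp (Dw : D (true :: _)) /=.
have -> : (r - 2).+2 = r by lia.
have -> : all D sing.
  rewrite all_map; apply/allP => i; rewrite mem_iota => i1 /=; apply: (gD.2 _ _ _ Dw).
  apply: (prefix_le_single (p := 0)) => //=.
  by rewrite size_cat !size_nseq; lia.
move=> /(_ erefl isT).
suff : zeros n.+1 (pair_word n.+1 (N.+1 - 2) (N.+1 - 1) ::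
   (true :: nseq N false ++ nseq (n - N) true) :: sing) <= N - r by lia.
rewrite zerosE -[N - r]card_ord.
have inj : injective (fun i : 'I_(N - r) => (inord (i + r.-1) : 'I_n.+1)).
  move=> i j /(congr1 val) /=; rewrite !inordK; [|by have := ltn_ord j; lia|by have := ltn_ord i; lia].
  by move=> h; apply: val_inj => /=; lia.
rewrite -[#|'I_(N - r)|](card_codom inj); apply: subset_leq_card; apply/subsetP => x.
rewrite inE /= nth_pair_word ltn_ord /= negb_or => /andP [/andP [x1 x2] /andP [x3 x4]].
have xn := ltn_ord x.
have x5 : 0 < x by move: x3; case: (x : nat).
have x6 : x <= N.
  rewrite leqNgt; apply/negP => Nx; move: x3; case: (nat_of_ord x) xn Nx => // y yn Ny /=.
  by rewrite nth_cat size_nseq ltnNge -ltnS Ny /= nth_nseq; case: ifP => //; lia.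
have x7 : r.-1 <= x.
  rewrite leqNgt; apply/negP => xr.
  have hin : pair_word n.+1 x x \in sing by apply: map_f; rewrite mem_iota; lia.
  by move/allP: x4 => /(_ _ hin); rewrite nth_pair_word xn eqxx.
have x8 : x - r.-1 < N - r by lia.
apply/codomP; exists (Ordinal x8); apply: val_inj; rewrite /= inordK; lia.
Qed.

(** If no word starts with 1, the first letter is dropped. Otherwise [j = 0] and [wise_graded]
    applies with [N = T + r]; since [N + 1 < 2^r], the graded bound is strictly below [2^-T]. *)
Lemma below_critical_step r n : 3 <= r ->
  below_critical r n -> graded_bound r n.+1 -> below_critical r n.+1.
Proof.
move=> r3 Hb Hg j [|T] D gD H Tj Dj.
  rewrite expn0 muln1; split=> [|E]; first exact: cnt_max.
  by apply: (cnt_full E); rewrite size_nseq subn0.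
have [z1|/cnt_pos [w sw Dw]] := posnP (cnt n (sec true D)).
  have [] := Hb j.-1 T _ (shifted_sec false gD) (wise_sec0 H).
  - lia.
  - by move=> w i Dw ij; apply: (Dj (false :: w) i.+1) => //; lia.
  move=> b0 eq0; rewrite /= z1 addn0 !expnS; split=> [|E]; first by lia.
  by apply: eq0; lia.
have j0 : j = 0 by case: j Tj Dj => // j _ /(_ _ 0 Dw erefl).
have [e1 e2] := expr_large r3.
have gr : graded r (T.+1 + r) n.+1 D by apply: (wise_graded gD _ H Dw).
have Tr : r <= T.+1 + r <= 2 ^ r - 2 by rewrite /critical in Tj; lia.
have [b _] := Hg _ _ gD gr Tr.
suff : cnt n.+1 D * 2 ^ T.+1 < 2 ^ n.+1 by lia.
rewrite -(@ltn_pmul2r (2 ^ r)) ?expn_gt0 // -mulnA -expnD.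
apply: leq_ltn_trans b _; rewrite mulnC ltn_pmul2l ?expn_gt0 //.
by rewrite /critical in Tj; lia.
Qed.

(* The Bernoulli-type bound (1 + 1/q)^k <= 1 + 2 k/q. *)
Lemma expn_succ_le q k : k.*2 <= q.+2 -> q.+1 ^ k * q <= q ^ k * (q + k.*2).
Proof.
elim: k => [|k IH] kq; first by rewrite !expn0 addn0.
have {}IH := IH (ltac:(lia)).
rewrite !expnS; have : (q + k.*2) * q.+1 <= q * (q + k.+1.*2) by nia.
move=> h; have := leq_mul (leqnn q.+1) IH; have := leq_mul (leqnn (q ^ k)) h; lia.
Qed.

Lemma expr_large2 r : 5 <= r -> 4 * r.-1 <= 2 ^ r.-1.
Proof.
move=> r5; have -> : r.-1 = (r - 5).+4 by lia.
elim: (r - 5) => // k; rewrite !expnS; lia.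
Qed.

(** For [q = 2^(r-1)] and the constant [c] of [above_critical], this is [c^r <= 1/q = 2 c - 1]. *)
Lemma succ_pow_le2 r : 3 <= r -> (2 ^ r.-1).+1 ^ r <= 2 * (2 ^ r.-1) ^ r.
Proof.
move=> r3; have [r5|] := leqP 5 r; last first.
  by case: r r3 => [|[|[|[|[|r]]]]] // _ _; apply/eqP; vm_compute.
have q0 : 0 < 2 ^ r.-1 by rewrite expn_gt0.
have h := expr_large2 r5; have h2 : r.*2 <= 2 ^ r.-1 by lia.
rewrite -(leq_pmul2r q0); apply: leq_trans (expn_succ_le _) _; first by lia.
by rewrite -mulnA mulnCA leq_mul2l; lia.
Qed.

(** The factor lost beyond the critical value is at most 3/2; for [r = 3] and [j = 2] this would
    fail. *)
Lemma succ_pow_le3 r j : 4 <= r -> j < r ->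
  2 * (2 ^ r.-1).+1 ^ j <= 3 * (2 ^ r.-1) ^ j.
Proof.
move=> r4 jr; have [r5|r5] := leqP 5 r; last first.
  have er : r = 4 by lia.
  subst r.
  by case: j jr => [|[|[|[|j]]]].
have q0 : 0 < 2 ^ r.-1 by rewrite expn_gt0.
have h := expr_large2 r5; have h2 : 4 * j <= 2 ^ r.-1 by lia.
rewrite -(leq_pmul2r q0) -mulnA.
apply: (leq_trans (leq_mul (leqnn 2) (expn_succ_le _))); first by lia.
have h3 : 2 * (2 ^ r.-1 + j.*2) <= 3 * 2 ^ r.-1 by lia.
have := leq_mul (leqnn ((2 ^ r.-1) ^ j)) h3; lia.
Qed.

(** The sections by 0 and 1 exceed the critical value by [j] and [j + r], and the mean of [c^j] and
    [c^(j + r)] is at most [c^(j + 1)]. *)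
Lemma above_critical_step r n : 3 <= r -> below_critical r n.+1 ->
  above_critical r n -> above_critical r n.+1.
Proof.
move=> r3 Hb Ha [|j] D gD H.
  rewrite addn0 !expn0 muln1 mul1n.
  by have [] // := Hb 0 _ _ gD H _; rewrite ?addn0.
have r1 : 0 < r by lia.
have T1 : 0 < critical r + j.+1 by lia.
have H0 : wise n r (critical r + j) (sec false D) by apply: wise_sec0; rewrite -addnS.
have H1 : wise n r (critical r + (j + r)) (sec true D).
  have := wise_sec1 gD r1 T1 H; have -> // : critical r + j.+1 + r.-1 = critical r + (j + r) by lia.
have {H0} b0 := Ha _ _ (shifted_sec _ gD) H0.
have {H1} b1 := Ha _ _ (shifted_sec _ gD) H1.
have q2 := succ_pow_le2 r3; have [_ e2] := expr_large r3.
move: b0 b1 q2; rewrite addnS addnA !(expnS 2) !expnD e2 /=.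
set q := 2 ^ r.-1; set c0 := cnt n (sec false D); set c1 := cnt n (sec true D).
set M := 2 ^ n; set t := 2 ^ critical r * 2 ^ j.
rewrite !expnS => b0 b1 q2.
have q0 : 0 < q by rewrite expn_gt0.
have qr0 : 0 < q ^ r by rewrite expn_gt0 q0.
have {}b0 : c0 * (2 * t) * (q * q ^ j) <= 2 * q * (q.+1 ^ j * M).
  by have := leq_mul (leqnn (2 * q)) b0; rewrite /t; lia.
have {}b1 : c1 * (2 * t) * (q * q ^ j) <= 2 * (q.+1 ^ j * M).
  rewrite -(leq_pmul2r qr0).
  have := leq_mul q2 (leqnn (q.+1 ^ j * M)); rewrite /t; lia.
rewrite mulnDl mulnDl; lia.
Qed.

Lemma pair_word_in n D w p a b : shifted n D -> D w -> nth false w 0 ->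
  0 < p -> nth false w p -> p <= b -> D (pair_word n a b).
Proof.
move=> gD Dw w0 p0 wp pb; apply: gD.2 (Dw).
by apply: (prefix_le_pair (p := 0) (q := p)) => //; apply: gD.1.
Qed.

Lemma pair_word_behead n a b D :
  D (pair_word n.+1 a.+1 b.+1) -> sec false D (pair_word n a b).
Proof. by rewrite pair_wordS. Qed.

(* At N = N0 the bound for r - 1 leaves a slack of N0 / 2 (in units of 2^(n - N)); every
   step up beyond the critical value then costs at most 1/2. *)
Lemma pair_bound_aux r n : 4 <= r ->
  (forall m, m < n -> below_critical r m) -> (forall m, m < n -> above_critical r m) ->
  (forall m, graded_bound r.-1 m) ->
  let N0 := 2 ^ r.-1 - 3 in
  forall k D, shifted n D -> graded r (N0 + k) n D -> N0 + k <= 2 ^ r - 2 ->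
  D (pair_word n k k.+1) -> k.+1 < n ->
  2 * (cnt n D * 2 ^ (N0 + k)) + N0 * 2 ^ n <=
    (2 * (N0 + k).+1 + (N0 + k - 1 - critical r)) * 2 ^ n.
Proof.
move=> r4 Hb Ha Hg N0; have r3 : 2 < r by lia.
have [e1 e2] := expr_large r3.
have e3 : 2 ^ r.-1 = 2 * 2 ^ r.-2 by rewrite -expnS; congr (2 ^ _); lia.
have [e4 _] : r.-1.+1 <= 2 ^ r.-1.-1 /\ _ := expr_large (ltac:(lia) : 2 < r.-1).
have e5 : r.+1 <= N0 by rewrite /N0; lia.
elim: n Hb Ha => [|n IH] Hb Ha; first by [].
case=> [|k] D gD gr kr Dp kn.
  (* The pair occupies the first two letters, so [graded_pair] applies; [N0 + 1 = 2^(r-1) - 2] is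
     the largest value that the bound for [r - 1] allows. *)
  rewrite addn0 in gr kr *.
  have r' : r = r.-1.+1 by lia.
  rewrite r' in gr.
  have g' : graded r.-1 N0.+1 n.+1 D.
    by apply: (graded_pair _ gD gr Dp); rewrite ?nth_pair_word //; lia.
  have rg : r.-1 <= N0.+1 <= 2 ^ r.-1 - 2 by rewrite /N0; lia.
  by have [b _] := Hg _ _ _ gD g' rg; rewrite (expnS 2 N0) in b; nia.
have g0 : graded r (N0 + k) n (sec false D) by apply: graded_sec0; rewrite -?addnS //; lia.
have g1 : wise n r (N0 + k) (sec true D).
  by apply: graded_sec1; rewrite -?addnS //; lia.
have := IH (fun m lt => Hb m (ltnW lt)) (fun m lt => Ha m (ltnW lt)) k _
  (shifted_sec false gD) g0 (ltac:(lia)) (pair_word_behead Dp) kn.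
(* The section by 1 costs one unit up to the critical value and at most 3/2 beyond it, that is 2 or
   3 in the doubled inequality. *)
suff : 2 * (cnt n (sec true D) * 2 ^ (N0 + k)) <=
   (2 + (N0 + k.+1 - 1 - critical r - (N0 + k - 1 - critical r))) * 2 ^ n.
  by rewrite /= addnS !expnS; nia.
have [le|gt] := leqP (N0 + k) (critical r).
  have [] // := Hb n (leqnn _) 0 _ _ (shifted_sec true gD) g1; first by lia.
  by move=> b _; nia.
pose j := N0 + k - critical r; have ej : N0 + k = critical r + j by lia.
have -> : N0 + k.+1 - 1 - critical r - (N0 + k - 1 - critical r) = 1 by lia.
rewrite ej in g1 *.
have b := Ha n (leqnn _) j _ (shifted_sec true gD) g1.
have jr : j < r by rewrite /j /critical in ej *; lia.
have := succ_pow_le3 r4 jr; set q := 2 ^ r.-1 in b *.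
have q0 : 0 < q ^ j by rewrite expn_gt0 expn_gt0.
move=> h; rewrite -(leq_pmul2r q0).
have := leq_mul h (leqnn (2 ^ n)); move: b; set x := cnt _ _ * _; lia.
Qed.

(** The two 1s move to [k] and [k + 1] with [k = N - N0]. In doubled units the extra cost
    [N - 1 - critical r] is below [r], hence below the slack [N0]. *)
Lemma pair_bound_step r n : 4 <= r ->
  (forall m, m < n -> below_critical r m) -> (forall m, m < n -> above_critical r m) ->
  (forall m, graded_bound r.-1 m) -> pair_bound r n.
Proof.
move=> r4 Hb Ha Hg N D w p gD gr Nr pr Dw w0 wp; have r3 : 2 < r by lia.
have [e1 e2] := expr_large r3.
have e3 : 2 ^ r.-1 = 2 * 2 ^ r.-2 by rewrite -expnS; congr (2 ^ _); lia.
have [e4 _] : r.-1.+1 <= 2 ^ r.-1.-1 /\ _ := expr_large (ltac:(lia) : 2 < r.-1).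
have Nn : N - 2 <= n by apply: (wise_leq (s := 2)) Dw; apply: gr; lia.
pose k := N - (2 ^ r.-1 - 3); rewrite /critical in Nr.
have ek : 2 ^ r.-1 - 3 + k = N by lia.
have Dp : D (pair_word n k k.+1) by apply: (pair_word_in _ gD Dw w0 _ wp); lia.
have := pair_bound_aux r4 Hb Ha Hg (k := k) gD; rewrite ek.
move=> /(_ gr (ltac:(lia)) Dp (ltac:(lia))).
have -> : (2 * N.+1 + (N - 1 - critical r)) * 2 ^ n =
   2 * (N.+1 * 2 ^ n) + (N - 1 - critical r) * 2 ^ n by rewrite mulnDl mulnA.
have : (N - 1 - critical r) * 2 ^ n < (2 ^ r.-1 - 3) * 2 ^ n.
  by rewrite ltn_pmul2r ?expn_gt0 // /critical; lia.
lia.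
Qed.

Lemma pair_word00 n : pair_word n.+1 0 0 = true :: nseq n false.
Proof.
apply: (@eq_from_nth _ false) => [|i _]; first by rewrite size_pair_word /= size_nseq.
rewrite nth_pair_word orbb; case: i => //= i; rewrite andbF.
by rewrite nth_nseq if_same.
Qed.

Lemma pair_word0S n b : pair_word n.+1 0 b.+1 = true :: pair_word n b b.
Proof.
apply: (@eq_from_nth _ false) => [|i _]; first by rewrite size_pair_word /= size_pair_word.
by rewrite nth_pair_word; case: i => //= i; rewrite nth_pair_word orbb.
Qed.

(** * Three-wise families containing pairs *)

Lemma three_wise_sec1 m T D : shifted m.+1 D -> wise m.+1 3 T.+1 D ->
  wise m 3 T.+3 (sec true D).
Proof. by move=> gD H; have := wise_sec1 gD (isT : 0 < 3) (isT : 0 < T.+1) H; rewrite addn2. Qed.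

Lemma three_wise3 m D : below_critical 3 m -> shifted m D -> wise m 3 3 D ->
  8 * cnt m D <= 2 ^ m.
Proof. by move=> Hb gD H; have [] // := Hb 0 _ _ gD H; lia. Qed.

(** The sections by 1, 01 and 001 are 3-wise 5-, 4- and 3-intersecting. In units of [2^m / 128] they
    count at most 25, 20 and 16, in sum 61. *)
Lemma three_wise_leaf3 m D :
  (forall k, k < m.+3 -> below_critical 3 k) -> (forall k, k < m.+3 -> above_critical 3 k) ->
  shifted m.+3 D -> wise m.+3 3 3 D ->
  128 * cnt m.+3 D <= 128 * cnt m (sec false (sec false (sec false D))) + 61 * 2 ^ m.
Proof.
move=> Hb Ha gD H.
have g0 := shifted_sec false gD; have H0 := wise_sec0 H.
have g00 := shifted_sec false g0; have H00 := wise_sec0 H0.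
have b1 := Ha m.+2 (leqnn _) 2 _ (shifted_sec true gD) (three_wise_sec1 gD H).
have b01 := Ha m.+1 (leqnSn _) 1 _ (shifted_sec true g0) (three_wise_sec1 g0 H0).
have b001 := three_wise3 (Hb m (ltac:(lia))) (shifted_sec true g00) (three_wise_sec1 g00 H00).
move: b1 b01 b001; rewrite -[critical 3]/(3) /= !expnS; lia.
Qed.

(** The section by 1 is 3-wise 6-intersecting and adds [125/512]; [125 + 4 * 61 = 369]. *)
Lemma three_wise_leaf4 m D :
  (forall k, k < m.+4 -> below_critical 3 k) -> (forall k, k < m.+4 -> above_critical 3 k) ->
  shifted m.+4 D -> wise m.+4 3 4 D ->
  512 * cnt m.+4 D <=
    512 * cnt m (sec false (sec false (sec false (sec false D)))) + 369 * 2 ^ m.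
Proof.
move=> Hb Ha gD H.
have g0 := shifted_sec false gD; have H0 := wise_sec0 H.
have b1 := Ha m.+3 (leqnn _) 3 _ (shifted_sec true gD) (three_wise_sec1 gD H).
have b0 := three_wise_leaf3 (fun k lt => Hb k (ltnW lt)) (fun k lt => Ha k (ltnW lt)) g0 H0.
have E : cnt m.+4 D = cnt m.+3 (sec false D) + cnt m.+3 (sec true D) by [].
move: b1 b0; rewrite E -[critical 3]/(3) !(expnS 2 m.+2, expnS 2 m.+1, expnS 2 m).
rewrite -[2 ^ (3 + 3)]/(64) -[(2 ^ 3.-1) ^ 3]/(64) -[(2 ^ 3.-1).+1 ^ 3]/125; lia.
Qed.

(** The section by 1 is 3-wise 7-intersecting and adds [625/2048]; [625 + 4 * 369 = 2101]. *)
Lemma three_wise_leaf5 m D :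
  (forall k, k < m.+4.+1 -> below_critical 3 k) -> (forall k, k < m.+4.+1 -> above_critical 3 k) ->
  shifted m.+4.+1 D -> wise m.+4.+1 3 5 D ->
  2048 * cnt m.+4.+1 D <=
    2048 * cnt m (sec false (sec false (sec false (sec false (sec false D))))) + 2101 * 2 ^ m.
Proof.
move=> Hb Ha gD H.
have g0 := shifted_sec false gD; have H0 := wise_sec0 H.
have b1 := Ha m.+4 (leqnn _) 4 _ (shifted_sec true gD) (three_wise_sec1 gD H).
have b0 := three_wise_leaf4 (fun k lt => Hb k (ltnW lt)) (fun k lt => Ha k (ltnW lt)) g0 H0.
have E : cnt m.+4.+1 D = cnt m.+4 (sec false D) + cnt m.+4 (sec true D) by [].
move: b1 b0; rewrite E -[critical 3]/(3) !(expnS 2 m.+3, expnS 2 m.+2, expnS 2 m.+1, expnS 2 m).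
rewrite -[2 ^ (3 + 4)]/128 -[(2 ^ 3.-1) ^ 4]/256 -[(2 ^ 3.-1).+1 ^ 4]/625; lia.
Qed.

Lemma prefix_le_swap u : prefix_le [:: false, true & u] [:: true, false & u].
Proof. by split=> // -[|[|m]]; rewrite ?ones0 // !ones_cons ?ones0. Qed.

Definition sec3 x y z A := sec z (sec y (sec x A)).

Lemma cnt_sec3 m A : cnt m.+3 A =
  cnt m (sec3 false false false A) + cnt m (sec3 true true true A) +
  (cnt m (sec3 false false true A) + cnt m (sec3 true true false A)) +
  (cnt m (sec3 false true false A) + cnt m (sec3 true false true A)) +
  (cnt m (sec3 true false false A) + cnt m (sec3 false true true A)).
Proof. rewrite /= /sec3; lia. Qed.

(* The eight sections of A form four antipodal pairs; three of them yield with W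
   triples to which cross3_bound applies. *)
Lemma octant_bound m A W : shifted m.+3 A -> shifted m W ->
  (forall x y z, cross3 m (sec3 x y z A) (sec3 (~~ x) (~~ y) (~~ z) A) W) ->
  (forall i j, i <= j < 3 -> A (pair_word m.+3 i j)) ->
  (exists2 w, W w & 0 < m -> nth false w 0) ->
  cnt m.+3 A <= 4 * 2 ^ m /\ 4 * cnt m.+3 A + 12 * cnt m W <= 19 * 2 ^ m.
Proof.
move=> gA gW cr hA [w Ww w0].
have W0 : 0 < cnt m W by apply: (cnt_gt0 _ Ww); apply: gW.1.
have g3 x y z : shifted m (sec3 x y z A) by do 3!apply: shifted_sec.
have h2 x y z : cnt m (sec3 x y z A) + cnt m (sec3 (~~ x) (~~ y) (~~ z) A) <= 2 ^ m.
  exact: cross3_cnt2 W0.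
have ne i j x y z : i <= j < 3 -> pair_word m.+3 i j = [:: x, y, z & nseq m false] ->
    0 < cnt m (sec3 x y z A).
  move=> ij E; apply: (@cnt_gt0 _ _ (nseq m false)); first by rewrite size_nseq.
  by rewrite /sec3 /sec -E hA.
have h3 x y z : 0 < cnt m (sec3 x y z A) -> 0 < cnt m (sec3 (~~ x) (~~ y) (~~ z) A) ->
    4 * (cnt m (sec3 x y z A) + cnt m (sec3 (~~ x) (~~ y) (~~ z) A) + cnt m W) <= 5 * 2 ^ m.
  case: m gA gW cr hA w0 W0 Ww g3 {h2 ne} => [|m] gA gW cr hA w0 W0 Ww g3 p1 p2.
    have [a sa Aa] := cnt_pos p1; have [b sb Ab] := cnt_pos p2.
    by have := cr _ _ _ _ _ _ Aa Ab Ww; rewrite /zeros big_ord0.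
  apply: cross3_bound => //; apply: ltn_addl.
  have sw := gW.1 _ Ww; case: w w0 sw Ww => //= b w /(_ isT) -> [sw] Ww.
  exact: cnt_gt0 Ww.
(* The antipodal pair 000, 111 counts at most 4 quarters of [2^m]; each of the other three pairs,
   together with [W], at most 5. *)
have := h2 false false false; have := h2 false false true.
have := h2 false true false; have := h2 true false false.
have n001 : 0 < cnt m (sec3 false false true A).
  by apply: (ne 2 2) => //; rewrite !pair_wordS pair_word00.
have n010 : 0 < cnt m (sec3 false true false A).
  by apply: (ne 1 1) => //; rewrite !pair_wordS pair_word00.
have n100 : 0 < cnt m (sec3 true false false A).
  by apply: (ne 0 0) => //; rewrite pair_word00.
have n110 : 0 < cnt m (sec3 true true false A).
  by apply: (ne 0 1) => //; rewrite pair_word0S pair_word00.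
have n101 : 0 < cnt m (sec3 true false true A).
  by apply: (ne 0 2) => //; rewrite pair_word0S pair_wordS pair_word00.
have n011 : 0 < cnt m (sec3 false true true A).
  by apply: (ne 1 2) => //; rewrite pair_wordS pair_word0S pair_word00.
have := h3 false false true n001 n110; have := h3 false true false n010 n101.
have := h3 true false false n100 n011; rewrite cnt_sec3 /=; lia.
Qed.

Lemma pair_bound3 n : (forall m, m < n -> below_critical 3 m) ->
  (forall m, m < n -> above_critical 3 m) -> pair_bound 3 n.
Proof.
move=> Hb Ha N D w p gD gr; rewrite -[critical 3]/(3) -[2 ^ 3]/8 => Nr pr Dw w0 wp.
have hp a b : 1 < b -> D (pair_word n a b).
  by move=> b1; apply: (pair_word_in _ gD Dw w0 _ wp); lia.
have hs a : D (pair_word n a a).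
  by apply: (gD.2 _ _ _ Dw); apply: (prefix_le_single (p := 0)) => //; apply: gD.1.
(* The word with 1s at 0 and 2 has [n - 2] zeros and needs at least [N - 2]. *)
have Nn : N <= n.
  have h : N - 2 <= zeros n [:: pair_word n 0 2; pair_word n 0 2].
    by apply: gr => //=; rewrite hp.
  have : zeros n [:: pair_word n 0 2; pair_word n 0 2] <= n - 2.
    have n3 : 2 < n by have := wise_leq (gr 2 isT) Dw; lia.
    rewrite (@eq_zeros _ _ [:: pair_word n 0 2]); last by move=> x; rewrite !inE orbb.
    have n0 : 0 < n by lia.
    have := @zeros_pair_word n [::] (Ordinal n0) (Ordinal n3) isT isT isT.
    by have := zeros_le n [::]; rewrite /=; lia.
  lia.
have N56 : N = 5 \/ N = 6 by lia.
have W0 : 0 < 3 by [].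
case: N56 => eN; subst N.
  have [m em] : {m | n = m.+4.+1} by exists (n - 5); lia.
  subst n.
  have gA : shifted m.+3 (sec false (sec false D)) by do 2!apply: shifted_sec.
  (* A word starting with 01000 and two words starting with 00 and antipodal triples share only the
     first zero among five letters, so their tails meet. *)
  pose W := sec false (sec false (sec false (sec true (sec false D)))).
  have gW : shifted m W by do 5!apply: shifted_sec.
  have [] := octant_bound gA gW.
  - move=> x y z a b c Aa Ab Wc.
    have := gr 3 isT [:: [:: false, false, x, y, z & a];
       [:: false, false, ~~ x, ~~ y, ~~ z & b]; [:: false, true, false, false, false & c]] erefl.
    rewrite /= (Aa : D _) (Ab : D _) (Wc : D _) => /(_ isT).
    by rewrite !zeros_recl /=; case: x y z {Aa Ab} => [] [] [].
  - move=> i j ij; do 2!apply: pair_word_behead; case: j ij => [|j] ij; last exact: hp.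
    by have -> : i = 0 by lia.
  - rewrite /W; move: hp hs; case: (m) => [|m'] hp hs.
      exists [::] => //; rewrite /sec; have := hs 1.
      by rewrite pair_wordS pair_word00.
    exists (true :: nseq m' false) => //; rewrite /sec; have := hp 1 5 isT.
    by rewrite pair_wordS pair_word0S !pair_wordS pair_word00.
  have g0 := shifted_sec false gD.
  have b3 := three_wise_leaf3 (fun k (lt : k < m.+3) => Hb k (ltac:(lia)))
    (fun k (lt : k < m.+3) => Ha k (ltac:(lia))) (shifted_sec true g0)
    (three_wise_sec1 g0 (wise_sec0 (gr 3 isT))).
  have b4 := three_wise_leaf4 (fun k (lt : k < m.+4) => Hb k (ltac:(lia)))
    (fun k (lt : k < m.+4) => Ha k (ltac:(lia))) (shifted_sec true gD)
    (three_wise_sec1 gD (gr 3 isT)).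
  have l4 : cnt m (sec false (sec false (sec false (sec false (sec true D))))) <= cnt m W.
    by apply: cnt_le => u su; apply: gD.2; apply: prefix_le_swap.
  (* In units of [2^m], the section by 00 plus twice [W] is at most 9/2; the leaves add [61/128] and
     [369/512], and the total stays below 6. *)
  move=> a1 a2; rewrite !(expnS 2 m.+4, expnS 2 m.+3, expnS 2 m.+2, expnS 2 m.+1, expnS 2 m).
  have E : cnt m.+4.+1 D = cnt m.+3 (sec false (sec false D)) +
     cnt m.+3 (sec true (sec false D)) + cnt m.+4 (sec true D) by [].
  rewrite E; move: b3 b4 l4 a1 a2; rewrite -/W; have := expn_gt0 2 m; lia.
  have [m em] : {m | n = m.+4.+2} by exists (n - 6); lia.
  subst n.
  have gA : shifted m.+3 (sec false (sec false (sec false D))) by do 3!apply: shifted_sec.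
  (* One more leading zero: two of the three common zeros required lie in the first six letters. *)
  pose W := sec false (sec false (sec false (sec true (sec false (sec false D))))).
  have gW : shifted m W by do 6!apply: shifted_sec.
  have [] := octant_bound gA gW.
  - move=> x y z a b c Aa Ab Wc.
    have := gr 3 isT [:: [:: false, false, false, x, y, z & a];
       [:: false, false, false, ~~ x, ~~ y, ~~ z & b]; [:: false, false, true, false, false, false & c]] erefl.
    rewrite /= (Aa : D _) (Ab : D _) (Wc : D _) => /(_ isT).
    by rewrite !zeros_recl /=; case: x y z {Aa Ab} => [] [] [].
  - move=> i j ij; do 3!apply: pair_word_behead; case: j ij => [|j] ij; last exact: hp.
    by have -> : i = 0 by lia.
  - rewrite /W; move: hp hs; case: (m) => [|m'] hp hs.
      exists [::] => //; rewrite /sec; have := hs 2.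
      by rewrite !pair_wordS pair_word00.
    exists (true :: nseq m' false) => //; rewrite /sec; have := hp 2 6 isT.
    by rewrite !pair_wordS pair_word0S !pair_wordS pair_word00.
  have g0 := shifted_sec false gD.
  have g00 := shifted_sec false g0.
  have b3 := three_wise_leaf3 (fun k (lt : k < m.+3) => Hb k (ltac:(lia)))
    (fun k (lt : k < m.+3) => Ha k (ltac:(lia))) (shifted_sec true g00)
    (three_wise_sec1 g00 (wise_sec0 (wise_sec0 (gr 3 isT)))).
  have b4 := three_wise_leaf4 (fun k (lt : k < m.+4) => Hb k (ltac:(lia)))
    (fun k (lt : k < m.+4) => Ha k (ltac:(lia))) (shifted_sec true g0)
    (three_wise_sec1 g0 (wise_sec0 (gr 3 isT))).
  have b5 := three_wise_leaf5 (fun k (lt : k < m.+4.+1) => Hb k (ltac:(lia)))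
    (fun k (lt : k < m.+4.+1) => Ha k (ltac:(lia))) (shifted_sec true gD)
    (three_wise_sec1 gD (gr 3 isT)).
  have l4 : cnt m (sec false (sec false (sec false (sec false (sec true (sec false D)))))) <= cnt m W.
    by apply: cnt_le => u su; apply: gD.2; apply/prefix_le_cons/prefix_le_swap.
  have l5 : cnt m (sec false (sec false (sec false (sec false (sec false (sec true D)))))) <=
      cnt m (sec false (sec false (sec false (sec false (sec true (sec false D)))))).
    by apply: cnt_le => u su; apply: gD.2; apply: prefix_le_swap.
  (* The section by 000 plus three times [W] is at most 19/4; with the leaves [61/128], [369/512]
     and [2101/2048] the total stays below 7. *)
  move=> a1 a2; rewrite !(expnS 2 m.+4.+1, expnS 2 m.+4, expnS 2 m.+3, expnS 2 m.+2, expnS 2 m.+1, expnS 2 m).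
  have E : cnt m.+4.+2 D = cnt m.+3 (sec false (sec false (sec false D))) +
     cnt m.+3 (sec true (sec false (sec false D))) + cnt m.+4 (sec true (sec false D)) +
     cnt m.+4.+1 (sec true D) by [].
  rewrite E; move: b3 b4 b5 l4 l5 a1 a2; rewrite -/W; have := expn_gt0 2 m; lia.
Qed.

(** * Induction on the word length and on [r] *)

Lemma core_induction r : 3 <= r ->
  (forall n, (forall m, m < n -> below_critical r m) ->
    (forall m, m < n -> above_critical r m) -> pair_bound r n) ->
  (forall n D, shifted n D -> graded r r n D -> cnt n D * 2 ^ r <= r.+1 * 2 ^ n) ->
  forall n, graded_bound r n.
Proof.
move=> r3 Hp H0 n.
(* The three bounds are proved together: at length [n + 1] the graded bound uses [below_critical] at
   shorter lengths, and in turn yields [below_critical], then [above_critical], at [n + 1]. *)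
suff [] : [/\ graded_bound r n, forall m, m < n.+1 -> below_critical r m
            & forall m, m < n.+1 -> above_critical r m] by [].
elim: n => [|n [Hg Hb Ha]].
  split=> [|[]// _|[]// _]; [exact: graded_bound0 | exact: below_critical0
    | exact: above_critical0].
have Hg' : graded_bound r n.+1.
  apply: graded_bound_step => //; [exact: Hb | exact: Hp | exact: H0].
have Hb' : below_critical r n.+1 by apply: below_critical_step => //; apply: Hb.
have Ha' : above_critical r n.+1 by apply: above_critical_step => //; apply: Ha.
split=> // m; rewrite ltnS leq_eqVlt => /orP [/eqP -> //|]; [exact: Hb | exact: Ha].
Qed.

(** The missing start [N = r] is the bound for [r - 1] at the same [N]; for [r = 3] it says that an
    intersecting family has density at most 1/2. *)
Lemma graded_bound_all r n : 3 <= r -> graded_bound r n.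
Proof.
move=> r3; have -> : r = (r - 3).+3 by lia.
elim: (r - 3) n => [|k IH] n.
  apply: core_induction => // [m|m D gD gr]; first exact: pair_bound3.
  have : cnt m D + cnt m D <= 2 ^ m.
    apply: cnt_cross2 => u v _ _ Du Dv.
    by apply: (gr 2 isT [:: u; v]); rewrite //= Du Dv.
  rewrite -[2 ^ 3]/8; lia.
apply: core_induction => // [m|m D gD gr]; first by move=> Hb Ha; apply: pair_bound_step.
have [|_ e2] := @expr_large k.+4; first by [].
have [|e1 _] := @expr_large k.+3; first by [].
have e3 : 2 ^ k.+3 = 2 * 2 ^ k.+2 by rewrite expnS.
have [||//] := IH m k.+4 D gD; last by move: e1 e3 => /=; lia.
by move=> s sk; apply: gr; lia.
Qed.

(** * Words and subsets *)

Fixpoint words n : seq (seq bool) :=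
  if n is m.+1 then map (cons false) (words m) ++ map (cons true) (words m)
  else [:: [::]].

Lemma mem_words n w : (w \in words n) = (size w == n).
Proof.
elim: n w => [|n IH] w /=; first by rewrite inE; case: w.
rewrite mem_cat; case: w => [|b w].
  by rewrite -[_ == _]/false; apply/negbTE/norP; split; apply/negP => /mapP [].
have nin b' : ((b :: w) \in map (cons b') (words n)) = (b == b') && (size w == n).
  case: eqP => [->|nb]; first by rewrite mem_map ?IH // => x y [].
  by apply/negP => /mapP [x _ []].
by rewrite !nin eqSS; case: b {nin}; rewrite /= ?orbF.
Qed.

Lemma uniq_words n : uniq (words n).
Proof.
elim: n => //= n IH; rewrite cat_uniq !map_inj_uniq ?IH /= ?andbT; try by move=> x y [].
by apply/hasPn => x /mapP [y _ ->]; apply/negP => /mapP [].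
Qed.

Lemma cnt_words n D : cnt n D = count D (words n).
Proof.
elim: n D => [|n IH] D /=; first by rewrite addn0.
by rewrite !IH count_cat !count_map.
Qed.

Definition word_set n w : {set 'I_n} := [set i : 'I_n | nth false w i].

Definition set_word n (G : {set 'I_n}) : seq bool := [seq i \in G | i <- enum 'I_n].

Lemma size_set_word n (G : {set 'I_n}) : size (set_word G) = n.
Proof. by rewrite size_map size_enum_ord. Qed.

Lemma nth_set_word n (G : {set 'I_n}) (i : 'I_n) : nth false (set_word G) i = (i \in G).
Proof. by rewrite (nth_map i) ?size_enum_ord // nth_ord_enum. Qed.

Lemma set_wordK n : cancel (@set_word n) (@word_set n).
Proof. by move=> G; apply/setP => i; rewrite inE nth_set_word. Qed.

Lemma word_setK n w : size w = n -> set_word (word_set n w) = w.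
Proof.
move=> sw; apply: (@eq_from_nth _ false); rewrite ?size_set_word // => i ni.
by rewrite (nth_set_word _ (Ordinal ni)) inE.
Qed.

Definition word_family n (F : {set {set 'I_n}}) : pred (seq bool) :=
  fun w => (size w == n) && (word_set n w \in F).

Lemma cnt_word_family n (F : {set {set 'I_n}}) : cnt n (word_family F) = #|F|.
Proof.
rewrite cnt_words -size_filter cardE.
rewrite -(size_map (@word_set n)); apply/perm_size/uniq_perm.
- rewrite map_inj_in_uniq ?filter_uniq ?uniq_words // => u v.
  rewrite !mem_filter !mem_words => /andP [_ /eqP su] /andP [_ /eqP sv] E.
  by rewrite -(word_setK su) E word_setK.
- exact: enum_uniq.
move=> G; rewrite mem_enum; apply/mapP/idP => [[w]|FG].
  by rewrite mem_filter => /andP [/andP [_ ?] _] ->.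
exists (set_word G); last by rewrite set_wordK.
by rewrite mem_filter mem_words /word_family size_set_word eqxx set_wordK FG.
Qed.

Definition few n N : pred (seq bool) := fun w => ones w N <= n.

Lemma eq_cnt n D E : D =1 E -> cnt n D = cnt n E.
Proof. by move=> DE; rewrite !cnt_words; apply: eq_count. Qed.

Lemma cnt_few0 N n : cnt (N + n) (few 0 N) = 2 ^ n.
Proof.
elim: N => [|N IH].
  rewrite add0n; elim: n => [|n IH] /=; first by rewrite /few ones0.
  rewrite expnS mul2n -addnn -{1}IH -IH.
  by congr addn; apply: eq_cnt => w; rewrite /few /sec !ones0.
rewrite addSn /= (@cnt0 _ (sec true _)) ?addn0 => [|w _]; last first.
  by rewrite /sec /few ones_cons.
by rewrite -IH; apply: eq_cnt => w; rewrite /sec /few ones_cons.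
Qed.

Lemma cnt_few1 N n : cnt (N + n) (few 1 N) = N.+1 * 2 ^ n.
Proof.
elim: N => [|N IH].
  by rewrite mul1n -(cnt_few0 0) add0n; apply: eq_cnt => w; rewrite /few !ones0.
rewrite addSn /= (@eq_cnt _ (sec false _) (few 1 N)); last first.
  by move=> w; rewrite /sec /few ones_cons.
rewrite (@eq_cnt _ (sec true _) (few 0 N)); last first.
  by move=> w; rewrite /sec /few ones_cons.
by rewrite IH cnt_few0; lia.
Qed.

Lemma ones_recr w m : ones w m.+1 = ones w m + nth false w m.
Proof. by rewrite /ones big_ord_recr. Qed.

Lemma ones_set_nth w i b m : i < size w ->
  ones (set_nth false w i b) m + (i < m) * nth false w i = ones w m + (i < m) * b.
Proof.
move=> iw; elim: m => [|m IH]; first by rewrite !ones0.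
rewrite !ones_recr nth_set_nth /=; case: (ltngtP i m) IH => [im|mi|->] IH.
- by rewrite ltnS (ltnW im) !mul1n in IH *; lia.
- by rewrite ltnS leqNgt mi !mul0n in IH *; lia.
- by rewrite ltnSn !mul1n !mul0n in IH *; lia.
Qed.

(** * From elementary moves to the prefix order *)

Section Stable.

Variables (n : nat) (D : pred (seq bool)).
Hypothesis sizeD : forall w, D w -> size w = n.
Hypothesis downD : forall w i, D w -> nth false w i -> D (set_nth false w i false).
Hypothesis shiftD : forall w i j, D w -> nth false w i -> i < j < n -> ~~ nth false w j ->
  D (set_nth false (set_nth false w i false) j true).

(** At the first difference [k] the 1 belongs to [w]. It is shifted to the next 0 of [w], or deleted
    if there is none. As [w] has only 1s in between, it keeps its lead over [v] there, and the new
    word still dominates [v]. *)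
Lemma stable_step v w : prefix_le v w -> D w -> v != w ->
  exists w', [/\ D w', prefix_le v w' & \sum_(m < n.+1) ones w' m < \sum_(m < n.+1) ones w m].
Proof.
move=> [svw vw] Dw nvw; have sw := sizeD Dw.
have /ex_minnP [k dk mink] : exists k, nth false v k != nth false w k.
  have [/existsP [k kP]|/existsPn H] := boolP [exists k : 'I_n, nth false v k != nth false w k].
    by exists k.
  case/eqP: nvw; apply: (@eq_from_nth _ false) => // i; rewrite svw sw => ni.
  by have := H (Ordinal ni); rewrite negbK => /eqP.
have eqk m : m <= k -> ones v m = ones w m.
  elim: m => [|m IH] mk; first by rewrite !ones0.
  rewrite !ones_recr IH ?(ltnW mk) //; congr (_ + nat_of_bool _); apply/eqP.
  by apply/negPn/negP => /mink; rewrite leqNgt mk.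
have [wk vk] : nth false w k /\ nth false v k = false.
  have := vw k.+1; rewrite !ones_recr eqk // leq_add2l.
  by move: dk; case: (nth false v k); case: (nth false w k).
have kn : k < n by rewrite ltnNge; apply/negP => nk; rewrite nth_default ?sw in wk.
have sum_lt w' : (forall m, ones w' m <= ones w m) -> ones w' k.+1 < ones w k.+1 ->
    \sum_(m < n.+1) ones w' m < \sum_(m < n.+1) ones w m.
  move=> le lt; rewrite (bigD1 (inord k.+1)) //= [X in _ < X](bigD1 (inord k.+1)) //=.
  by rewrite -addSn leq_add ?inordK ?leq_sum.
have gap j : (forall i, k < i < j -> i < n -> nth false w i) ->
    forall m, k < m <= j -> ones v m < ones w m.
  move=> wj; elim=> // m IH /andP []; rewrite ltnS leq_eqVlt => /orP [/eqP <- _|km mj].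
    by rewrite !ones_recr eqk // vk wk addn0 addn1.
  rewrite !ones_recr; have := IH; rewrite km ltnW // => /(_ isT).
  case: (ltnP m n) => mn; first by rewrite wj ?km //; case: (nth _ _ _); lia.
  by rewrite !nth_default ?svw ?sw //; lia.
have [/existsP [j0 j0P]|/existsPn H] := boolP [exists j : 'I_n, (k < j) && ~~ nth false w j].
  have /ex_minnP [j /andP [/andP [kj jn] wj] minj] : exists j, (k < j < n) && ~~ nth false w j.
    by exists j0; rewrite ltn_ord andbT.
  have e m : ones (set_nth false (set_nth false w k false) j true) m + (k < m) =
      ones w m + (j < m).
    have := @ones_set_nth (set_nth false w k false) j true m.
    have := @ones_set_nth w k false m; rewrite size_set_nth sw kn => /(_ isT).
    rewrite nth_set_nth /= gtn_eqF // (negbTE wj) wk (maxn_idPr kn) jn => h /(_ isT); lia.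
  exists (set_nth false (set_nth false w k false) j true); split.
  - by apply: shiftD => //; rewrite kj.
  - split=> [|m]; first by rewrite !size_set_nth svw sw (maxn_idPr kn) (maxn_idPr jn).
    have := vw m; have := e m; case: (ltnP k m) => km; case: (ltnP j m) => jm; try lia.
    have gj : forall i, k < i < j -> i < n -> nth false w i.
      move=> i /andP [ki ij] iN; apply/negPn/negP => wi.
      by have := minj i; rewrite ki iN wi /= leqNgt ij => /(_ isT).
    by have := gap j gj m; rewrite km jm => /(_ isT); lia.
  - apply: sum_lt => [m|]; last by have := e k.+1; rewrite ltnSn ltnS leqNgt kj; lia.
    by have := e m; case: (ltnP k m) => km; case: (ltnP j m) => jm; lia.
have e m : ones (set_nth false w k false) m + (k < m) = ones w m.
  by have := @ones_set_nth w k false m; rewrite sw kn wk => /(_ isT); lia.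
exists (set_nth false w k false); split.
- exact: downD.
- split=> [|m]; first by rewrite size_set_nth svw sw (maxn_idPr kn).
  have := vw m; have := e m; case: (ltnP k m) => km; last by lia.
  have gm : forall i, k < i < m -> i < n -> nth false w i.
    move=> i /andP [ki _] iN; apply/negPn/negP => wi.
    by have := H (Ordinal iN); rewrite /= ki wi.
  by have := gap m gm m; rewrite km leqnn => /(_ isT); lia.
- apply: sum_lt => [m|]; last by have := e k.+1; rewrite ltnSn; lia.
  by have := e m; lia.
Qed.

Lemma stable_shifted : shifted n D.
Proof.
split=> // v w; have [s] := ubnP (\sum_(m < n.+1) ones w m); elim: s w => // s IH w ws vw Dw.
have [->//|nvw] := eqVneq v w.
have [w' [Dw' vw' lt]] := stable_step vw Dw nvw.
by apply: IH Dw' => //; apply: leq_trans lt _.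
Qed.

End Stable.

End Words.

(** * Compressions and their inversion *)

Section Families.

Variable n : nat.
Implicit Types (F : {set {set 'I_n}}) (G U : {set 'I_n}) (Gs : seq {set 'I_n}).

Definition agree_in Gs (x : 'I_n) := all (fun G => x \in G) Gs || all (fun G => x \notin G) Gs.

Definition agreeing s k F := forall Gs, size Gs = s -> all (mem F) Gs ->
  k <= #|[set x | agree_in Gs x]|.

Lemma in_symdiff G U x : (x \in symdiff G U) = (x \in G) (+) (x \in U).
Proof. by rewrite !inE; case: (x \in G); case: (x \in U). Qed.

(** The common form of down-compressions ([s] toggles an element) and shifts ([s] swaps two): a
    [bad] set is replaced unless its image is already in [F]. *)
Definition compress (s : {set 'I_n} -> {set 'I_n}) (bad : pred {set 'I_n}) F :=
  [set (if bad G && (s G \notin F) then s G else G) | G in F].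

(** The terms [n - x] are positive and decrease in [x], so deleting an element or moving it to the
    right lowers the weight. *)
Definition weight G := \sum_(x in G) (n - x).

Definition total_weight F := \sum_(G in F) weight G.

Section Compression.

Variables (s : {set 'I_n} -> {set 'I_n}) (bad : pred {set 'I_n}).
Hypothesis sK : involutive s.
Hypothesis bad_s : forall G, bad G -> ~~ bad (s G).

Lemma compress_inj F :
  {in F &, injective (fun G => if bad G && (s G \notin F) then s G else G)}.
Proof.
move=> G U FG FU; case: ifP => [/andP [_ nG]|_]; case: ifP => [/andP [_ nU]|_] //.
- exact: (can_inj sK).
- by move=> E; rewrite E FU in nG.
- by move=> E; rewrite -E FG in nU.
Qed.

Lemma card_compress F : #|compress s bad F| = #|F|.
Proof. by rewrite card_in_imset //; apply: compress_inj. Qed.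

Lemma mem_compress F G : (G \in compress s bad F) =
  if bad G then (G \in F) && (s G \in F)
  else if bad (s G) then (G \in F) || (s G \in F) else G \in F.
Proof.
apply/imsetP/idP => [[U FU ->]|].
  have [/andP [bU nU]|] := boolP (bad U && (s U \notin F)).
    by rewrite sK (negbTE (bad_s bU)) bU FU orbT.
  case: (boolP (bad U)) => /= [bU /negPn -> //|nb _]; first by rewrite FU.
  by rewrite FU if_same.
case: ifP => [bG /andP [FG FsG]|nbG]; first by exists G; rewrite // bG FsG.
have keep : G \in F -> exists2 U, U \in F & G = (if bad U && (s U \notin F) then s U else U).
  by move=> FG; exists G; rewrite // nbG.
case: ifP => // bsG; case: (boolP (G \in F)) => [/keep //|nFG FsG].
by exists (s G); rewrite // bsG sK nFG.
Qed.

Lemma total_weight_compress F : (forall G, bad G -> weight (s G) < weight G) ->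
  compress s bad F != F -> total_weight (compress s bad F) < total_weight F.
Proof.
move=> Hw ne; rewrite /total_weight big_imset /=; last exact: compress_inj.
have [/exists_inP [G FG /andP [bG nG]]|] :=
  boolP [exists G in F, bad G && (s G \notin F)]; last first.
  move/exists_inPn => H; case/eqP: ne; rewrite -[RHS]imset_id; apply: eq_in_imset => G FG.
  by rewrite (negbTE (H G FG)).
rewrite (bigD1 G) //= [X in _ < X](bigD1 G) //= bG nG -addSn; apply: leq_add; first exact: Hw.
by apply: leq_sum => U _; case: ifP => // /andP [bU _]; apply/ltnW/Hw.
Qed.

(** If the list contains a new set, replace new sets by their preimages and bad ones, which were
    kept, by their images: all of these lie in [F]. The injection [p] carries coordinates where the
    replacements agree to ones where the given sets agree. *)
Lemma agreeing_compress F q k (p : 'I_n -> 'I_n) : injective p ->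
  (forall Gs Gs' G, bad (s G) -> s G \in Gs' ->
     (forall U, U \in Gs -> if bad U then s U \in Gs'
                            else (U \in Gs') || (s U \in Gs')) ->
     forall x, agree_in Gs' x -> agree_in Gs (p x)) ->
  agreeing q k F -> agreeing q k (compress s bad F).
Proof.
move=> pI Hx HF Gs sGs aGs.
have [allF|/allPn [G0 G0s nF0]] := boolP (all (mem F) Gs); first exact: HF.
have c0 := allP aGs _ G0s.
have [b0 Fs0] : bad (s G0) /\ s G0 \in F.
  move: c0 nF0; rewrite /= mem_compress; case: ifP => [_ /andP [-> //]|_].
  by case: ifP => [_|_ -> //]; case: (G0 \in F).
pose rep U := if bad U then s U else if bad (s U) && (U \notin F) then s U else U.
have repF : all (mem F) (map rep Gs).
  rewrite all_map; apply/allP => U Us; have := allP aGs _ Us.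
  rewrite /= /rep mem_compress; case: (bad U) => [/andP [] //|].
  by case: (bad (s U)) => //=; case: (boolP (U \in F)) => //= nU.
apply: leq_trans (HF (map rep Gs) _ repF) _; first by rewrite size_map.
rewrite -(card_imset _ pI); apply: subset_leq_card; apply/subsetP => y /imsetP [x].
rewrite !inE => ax ->; apply: (Hx Gs (map rep Gs) G0) ax => //.
- have -> : s G0 = rep G0.
    by rewrite /rep b0 -[bad G0](negbK) -{2}[G0]sK (bad_s b0) /= nF0.
  exact: map_f.
- move=> U Us; have := map_f rep Us; rewrite /rep; case: (bad U) => //.
  by case: ifP => [_ ->|_ ->]; rewrite ?orbT.
Qed.

Lemma split_compress F G : G \in compress s bad F -> s G \notin compress s bad F ->
  G \in F \/ s G \in F.
Proof.
rewrite !mem_compress sK; case bG : (bad G); first by case/andP=> ->; left.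
case bsG : (bad (s G)); last by left.
by move/orP.
Qed.

(** A pair [G], [s G] of which the compression contains both or neither was left alone; only split
    pairs matter. *)
Lemma compress_kept F : (forall G, ~~ bad G -> ~~ bad (s G) -> s G = G) ->
  (forall G, G \in compress s bad F -> s G \notin compress s bad F -> G \in F) ->
  compress s bad F = F.
Proof.
move=> fixs H; apply/setP => G; have := H G; have := H (s G).
rewrite !mem_compress sK; have := bad_s (G := G); have := fixs G.
case: (bad G); case: (bad (s G)) => /=; try by [].
- by move=> _ /(_ isT).
- by case: (G \in F); case: (s G \in F) => //= _ _ H1 H2; rewrite ?H1 ?H2.
- by case: (G \in F); case: (s G \in F) => //= _ _ H1 H2; rewrite ?H1 ?H2.
Qed.

(** The opposite extreme: all split pairs were moved, and the other pairs are invariant under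
    [s]. *)
Lemma compress_moved F : (forall G, ~~ bad G -> ~~ bad (s G) -> s G = G) ->
  (forall G, G \in compress s bad F -> s G \notin compress s bad F -> s G \in F) ->
  forall G, (G \in F) = (s G \in compress s bad F).
Proof.
move=> fixs H G; have := H G; have := H (s G).
rewrite !mem_compress sK; have := bad_s (G := G); have := fixs G.
case: (bad G); case: (bad (s G)) => /=; try by [].
- by move=> _ /(_ isT).
- by case: (G \in F); case: (s G \in F) => //= _ _ H1 H2; have := H1 isT isT.
- by case: (G \in F); case: (s G \in F) => //= _ _ H1 H2; have := H2 isT isT.
- by move=> /(_ isT isT) ->.
Qed.

(* A kept and a moved split set with different labels a, b, completed by a split set with
   a third label c that is complementary to the kept one outside A0 and D0,
   agree at most on A0 minus {a, b, c}. *)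
Lemma split_uniform F (split : pred {set 'I_n}) (A0 D0 R : {set 'I_n}) k :
  agreeing 3 k F -> 2 < #|A0| < k + 3 ->
  (forall y, y \in A0 -> y \notin D0) ->
  (forall G, split G -> exists2 a, a \in A0 &
     forall y, y \in A0 -> (y \in G) (+) (y \in R) = (y == a)) ->
  (forall G, split G -> G \in F \/ s G \in F) ->
  (forall G y, y \notin D0 -> (y \in s G) = (y \in G)) ->
  (forall G1 G2 y, split G1 -> split G2 -> y \in D0 -> (y \in G1) = (y \notin s G2)) ->
  (forall c U, c \in A0 -> exists G, [/\ split G,
     forall y, y \in A0 -> (y \in G) (+) (y \in R) = (y == c)
     & forall y, y \notin A0 -> y \notin D0 -> (y \in G) = (y \in U)]) ->
  (forall G, split G -> G \in F) \/ (forall G, split G -> s G \in F).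
Proof.
move=> H3 A0k disj lab inF sD D0P fill.
have key G1 G2 a b : a \in A0 -> b \in A0 -> a != b -> split G1 -> split G2 ->
    (forall y, y \in A0 -> (y \in G1) (+) (y \in R) = (y == a)) ->
    (forall y, y \in A0 -> (y \in G2) (+) (y \in R) = (y == b)) ->
    G1 \in F -> s G2 \in F -> False.
  move=> aA bA ab s1 s2 l1 l2 F1 F2.
  have cab : 0 < #|A0 :\ a :\ b|.
    by move: A0k; rewrite (cardsD1 a) aA (cardsD1 b) !inE bA eq_sym ab !add1n !ltnS => /andP [].
  have [c] := card_gt0P cab; rewrite !inE => /and3P [cb ca cA].
  have [G3 [s3 l3 o3]] := fill c (~: G1) cA.
  have [X XF XG] : exists2 X, X \in F & forall y, y \notin D0 -> (y \in X) = (y \in G3).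
    by case: (inF _ s3) => ?; [exists G3 | exists (s G3) => // y; apply: sD].
  have := H3 [:: G1; s G2; X] erefl; rewrite /= F1 F2 XF => /(_ isT).
  apply/negP; rewrite -ltnNge.
  have lt : #|A0 :\ a :\ b :\ c| < k.
    move: A0k; rewrite (cardsD1 a A0) aA (cardsD1 b (A0 :\ a)) !inE bA eq_sym ab.
    by rewrite (cardsD1 c (A0 :\ a :\ b)) !inE cA ca cb !add1n addn3 !ltnS => /andP [].
  apply: leq_ltn_trans lt; apply: subset_leq_card; apply/subsetP => y.
  rewrite !inE /agree_in /= !andbT.
  have [yD|nyD] := boolP (y \in D0).
    by rewrite (D0P _ _ _ s1 s2 yD); case: (y \in s G2).
  rewrite (sD _ _ nyD) (XG _ nyD); have [yA|nyA] := boolP (y \in A0); last first.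
    by rewrite (o3 _ nyA nyD) inE; case: (y \in G1); rewrite /= ?andbF.
  rewrite ?andbT => agr.
  have e1 := l1 y yA; have e2 := l2 y yA; have e3 := l3 y yA.
  have [yc|_] := eqVneq y c; last have [yb|_] := eqVneq y b; last have [ya|//] := eqVneq y a.
  - rewrite yc eqxx (negbTE ca) (negbTE cb) in e1 e2 e3 agr.
    by move: e1 e2 e3 agr; case: (c \in R); case: (c \in G1); case: (c \in G2); case: (c \in G3).
  - rewrite yb eqxx eq_sym (negbTE ab) in e1 e2 agr.
    by move: e1 e2 agr; case: (b \in R); case: (b \in G1); case: (b \in G2).
  - rewrite ya eqxx (negbTE ab) in e1 e2 agr.
    by move: e1 e2 agr; case: (a \in R); case: (a \in G1); case: (a \in G2).
have [/forall_inP H|/forall_inPn [G2 s2 nF2]] := boolP [forall (G | split G), G \in F].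
  by left=> G /H.
right=> G1 s1; case: (inF _ s1) => // F1.
have F2 : s G2 \in F by case: (inF _ s2) => // F2; rewrite F2 in nF2.
have [a aA la] := lab _ s1; have [b bA lb] := lab _ s2.
have [eab|nab] := eqVneq a b; last by case: (key _ _ _ _ aA bA nab s1 s2 la lb F1 F2).
(* For equal labels, a split set with another label [c] is kept or moved, and forms with one of the
   two a pair excluded by [key]. *)
have [c] : exists c, c \in A0 :\ a.
  apply/card_gt0P; case/andP: A0k => A0k _.
  by apply: ltnW; move: A0k; rewrite (cardsD1 a) aA add1n.
rewrite !inE => /andP [ca cA]; have [G3 [s3 l3 _]] := fill c set0 cA.
case: (inF _ s3) => F3.
  by rewrite -eab in lb bA; case: (key _ _ _ _ cA bA ca s3 s2 l3 lb F3 F2).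
by rewrite eq_sym in ca; case: (key _ _ _ _ aA cA ca s1 s3 la l3 F1 F3).
Qed.

End Compression.

End Families.

(** * Down-compressions, shifts and balls *)

Section Operations.

Variable n : nat.
Implicit Types (F : {set {set 'I_n}}) (G U A R : {set 'I_n}) (x y i j : 'I_n).

Definition ball A R := [set G | #|symdiff G R :&: A| <= 1].

Definition toggle x G := [set y | (y \in G) (+) (y == x)].

Definition swap i j G := [set y | tperm i j y \in G].

Lemma in_toggle x G y : (y \in toggle x G) = (y \in G) (+) (y == x).
Proof. by rewrite inE. Qed.

Lemma toggleK x : involutive (toggle x).
Proof. by move=> G; apply/setP => y; rewrite !inE -addbA addbb addbF. Qed.

Lemma swapK i j : involutive (swap i j).
Proof. by move=> G; apply/setP => y; rewrite !inE tpermK. Qed.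

Definition squash x := compress (toggle x) (fun G => x \in G).

Definition shift i j := compress (swap i j) (fun G => (i \in G) && (j \notin G)).

Lemma toggle_bad x G : x \in G -> ~~ (x \in toggle x G).
Proof. by move=> xG; rewrite inE xG eqxx. Qed.

Lemma swap_bad i j G : (i \in G) && (j \notin G) ->
  ~~ ((i \in swap i j G) && (j \notin swap i j G)).
Proof. by rewrite !inE tpermL tpermR => /andP [-> /negbTE ->]. Qed.

Lemma toggle_fix x G : x \notin G -> x \notin toggle x G -> toggle x G = G.
Proof. by move=> xG; rewrite inE eqxx (negbTE xG). Qed.

Lemma swap_fix i j G : ~~ ((i \in G) && (j \notin G)) ->
  ~~ ((i \in swap i j G) && (j \notin swap i j G)) -> swap i j G = G.
Proof.
rewrite !inE tpermL tpermR => h1 h2; have e : (i \in G) = (j \in G).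
  by move: h1 h2; case: (i \in G); case: (j \in G).
by apply/setP => y; rewrite inE; case: tpermP => // ->.
Qed.

Lemma weight_toggle x G : x \in G -> weight (toggle x G) < weight G.
Proof.
move=> xG; rewrite /weight [X in _ < X](bigD1 x) //=.
have -> : \sum_(y in toggle x G) (n - y) = \sum_(y in G | y != x) (n - y).
  apply: eq_bigl => y; rewrite !inE.
  by case: eqP => [->|_]; rewrite ?xG ?addbF ?andbT.
by rewrite -[X in X < _]add0n ltn_add2r subn_gt0.
Qed.

Lemma weight_swap i j G : i < j -> (i \in G) && (j \notin G) -> weight (swap i j G) < weight G.
Proof.
move=> ij /andP [iG jG]; have jn := ltn_ord j.
have nij : i != j by rewrite neq_ltn ij.
rewrite /weight [X in _ < X](bigD1 i) //= (bigD1 j) /=; last by rewrite inE tpermR.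
have -> : \sum_(y in swap i j G | y != j) (n - y) = \sum_(y in G | y != i) (n - y).
  apply: eq_bigl => y; rewrite !inE; case: tpermP => [->|->|].
  - by rewrite eqxx (negbTE jG) andbF.
  - by rewrite (negbTE jG) eqxx andbF.
  by move=> /eqP -> /eqP ->.
by rewrite ltn_add2r; lia.
Qed.

(** One replacement contains [x], so if all agree on [x] they contain it; then no given set does,
    since the replacement of a bad set lacks [x]. Other coordinates are unaffected. *)
Lemma agreeing_squash x F q k : agreeing q k F -> agreeing q k (squash x F).
Proof.
apply: (agreeing_compress (toggleK x) (@toggle_bad x) (p := id)) => // Gs Gs' G bsG sG mGs y.
have [->|yx] := eqVneq y x => ax.
  have {}ax U : U \in Gs' -> x \in U.
    by case/orP: ax => /allP H; [exact: H | have := H _ sG; rewrite bsG].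
  apply/orP; right; apply/allP => U Us; have := mGs U Us; case: ifP => //.
  by move=> xU /ax; rewrite (negbTE (toggle_bad xU)).
have ty U : (y \in toggle x U) = (y \in U) by rewrite inE (negbTE yx) addbF.
have {}mGs U : U \in Gs -> exists2 V, V \in Gs' & (y \in V) = (y \in U).
  move=> /mGs; case: ifP => _; first by exists (toggle x U).
  by case/orP; [exists U | exists (toggle x U)].
by case/orP: ax => /allP H; apply/orP; [left|right]; apply/allP => U /mGs [V Vs <-]; exact: H.
Qed.

(** One replacement contains [i] but not [j]. Agreement of the replacements on [i] thus makes all
    given sets contain [j], and agreement on [j] makes them all avoid [i]; hence [p] is the
    transposition. *)
Lemma agreeing_shift i j F q k : i != j -> agreeing q k F -> agreeing q k (shift i j F).
Proof.
move=> ij; apply: (agreeing_compress (swapK i j) (@swap_bad i j) (p := tperm i j)).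
  exact: perm_inj.
move=> Gs Gs' G /andP [isG jsG] sG mGs y ay.
have iin U : (i \in swap i j U) = (j \in U) by rewrite inE tpermL.
have jin U : (j \in swap i j U) = (i \in U) by rewrite inE tpermR.
move: ay; case: tpermP => [->|->|/eqP yi /eqP yj] ay.
- have {}ay U : U \in Gs' -> i \in U.
    by case/orP: ay => /allP H; [exact: H | have := H _ sG; rewrite isG].
  apply/orP; left; apply/allP => U Us; have := mGs U Us.
  case: ifP => [/andP [iU jU] /ay|h /orP [/ay iU|/ay]]; rewrite ?iin ?(negbTE jU) //.
  by move: h; rewrite iU /= => /negbFE.
- have {}ay U : U \in Gs' -> j \notin U.
    by case/orP: ay => /allP H; [have := H _ sG; rewrite (negbTE jsG) | exact: H].
  apply/orP; right; apply/allP => U Us; have := mGs U Us.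
  case: ifP => [/andP [iU jU] /ay|h /orP [/ay jU|/ay]]; rewrite ?jin ?iU //.
  by move: h; rewrite jU andbT => ->.
have ty U : (y \in swap i j U) = (y \in U) by rewrite inE tpermD // eq_sym.
have {}mGs U : U \in Gs -> exists2 V, V \in Gs' & (y \in V) = (y \in U).
  move=> /mGs; case: ifP => _; first by exists (swap i j U).
  by case/orP; [exists U | exists (swap i j U)].
by case/orP: ay => /allP H; apply/orP; [left|right]; apply/allP => U /mGs [V Vs <-]; exact: H.
Qed.

Definition subclosed F := forall G x, G \in F -> x \in G -> G :\ x \in F.

Lemma mem_shift i j F G : (G \in shift i j F) =
  if (i \in G) && (j \notin G) then (G \in F) && (swap i j G \in F)
  else if (j \in G) && (i \notin G) then (G \in F) || (swap i j G \in F) else G \in F.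
Proof.
by rewrite /shift (mem_compress (swapK i j) (@swap_bad i j)) !(in_set, tpermL, tpermR).
Qed.

Lemma subclosed_shift i j F : i != j -> subclosed F -> subclosed (shift i j F).
Proof.
move=> ij dF G x; rewrite !mem_shift.
have [-> | xi] := eqVneq x i; last have [-> | xj] := eqVneq x j.
- move=> H iG; rewrite !inE eqxx (eq_sym j) ij /= andbT; move: H; rewrite iG /= andbF.
  by case: (j \in G) => /= [GF|/andP [GF _]]; rewrite dF.
- move=> H jG; rewrite !inE eqxx ij /= andbT; move: H; rewrite jG /= andbF.
  have e : swap i j (G :\ j) = swap i j G :\ i.
    apply/setP => y; rewrite !inE; case: tpermP => [->|->|/eqP yi /eqP yj].
    - by rewrite !eqxx.
    - by rewrite ij eq_sym ij.
    - by rewrite yi yj.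
  case: (boolP (i \in G)) => iG /= GF.
    rewrite dF //= e; suff -> : swap i j G = G by rewrite dF.
    by apply: swap_fix; rewrite ?inE ?tpermL ?tpermR iG jG.
  case/orP: GF => GF; first by rewrite dF.
  have -> : G :\ j = swap i j G :\ i.
    rewrite -e; apply/esym/swap_fix; rewrite ?inE ?tpermL ?tpermR ?inE (negbTE iG) ?andbF //.
    by rewrite eqxx.
  by rewrite dF // inE tpermL.
have -> : swap i j (G :\ x) = swap i j G :\ x.
  apply/setP => y; rewrite !inE; case: tpermP => // ->.
    by rewrite (eq_sym j) (negbTE xj) eq_sym (negbTE xi).
  by rewrite (eq_sym i) (negbTE xi) eq_sym (negbTE xj).
move=> H xG; have xs : x \in swap i j G by rewrite inE tpermD // eq_sym.
move: H; rewrite !inE (eq_sym i) (eq_sym j) (negbTE xi) (negbTE xj) /=.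
case: ifP => _ => [/andP [h1 h2]|]; first by rewrite !dF.
by case: ifP => _ => [/orP [h|h]|h]; rewrite ?(dF _ _ h) ?orbT.
Qed.

Lemma in_ball A R G : (G \in ball A R) = (#|symdiff G R :&: A| <= 1).
Proof. by rewrite inE. Qed.

Lemma in_ballD1 x A R G : x \in A ->
  (G \in ball A R) = ((x \in symdiff G R) + #|symdiff G R :&: (A :\ x)| <= 1).
Proof. by move=> xA; rewrite inE (cardsD1 x) in_setI xA andbT setIDA. Qed.

Lemma symdiff_toggle x G R : symdiff (toggle x G) R = toggle x (symdiff G R).
Proof. by apply/setP => y; rewrite !(in_symdiff, in_toggle) addbAC. Qed.

Lemma symdiff_toggler x G R : symdiff G (toggle x R) = toggle x (symdiff G R).
Proof. by apply/setP => y; rewrite !(in_symdiff, in_toggle) addbA. Qed.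

(** For [x] outside [A] the ball is invariant. Otherwise a split set agrees with [R] on [x] and
    differs from it in one element of [A :\ x], its label. All kept gives [R], all moved gives [R]
    toggled at [x]. *)
Lemma squash_ball x F A R k : 0 < k -> #|A| = k + 3 -> R \subset A -> agreeing 3 k F ->
  squash x F = ball A R -> exists2 R' : {set 'I_n}, R' \subset A & F = ball A R'.
Proof.
move=> k0 cA RA H3 E; have [xA|xA] := boolP (x \in A); last first.
  exists R => //; rewrite -E; apply/esym/(compress_kept (toggleK x) (@toggle_bad x) (@toggle_fix x)).
  move=> G; rewrite -/(squash x F) E !in_ball symdiff_toggle.
  have -> : toggle x (symdiff G R) :&: A = symdiff G R :&: A.
    apply/setP => y; rewrite !in_setI in_toggle; case: eqP => [->|_]; last by rewrite addbF.
    by rewrite (negbTE xA) !andbF.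
  by move=> ->.
pose split G := (G \in ball A R) && (toggle x G \notin ball A R).
have splitE G : split G = (x \notin symdiff G R) && (#|symdiff G R :&: (A :\ x)| == 1).
  rewrite /split !(in_ballD1 _ _ xA) symdiff_toggle.
  have -> : toggle x (symdiff G R) :&: (A :\ x) = symdiff G R :&: (A :\ x).
    by apply/setP => y; rewrite !(in_setI, in_toggle, in_setD1); case: eqP => _; rewrite ?andbF ?addbF.
  by rewrite in_toggle eqxx; case: (x \in _) => /=; lia.
have cA0 : #|A :\ x| = k + 2 by move: cA; rewrite (cardsD1 x) xA add1n addn3 addn2 => -[].
case: (@split_uniform _ (toggle x) F split (A :\ x) [set x] R k) => //.
- by rewrite cA0 addn2 addn3 !ltnS k0 /=.
- by move=> y; rewrite !inE => /andP [].
- move=> G; rewrite splitE => /andP [_ /cards1P [a ea]]; exists a.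
    by have := set11 a; rewrite -ea in_setI => /andP [].
  by move=> y yA; rewrite -in_symdiff -[LHS]andbT -yA -in_setI ea inE.
- by move=> G /andP []; rewrite -E; apply: (split_compress (toggleK x) (@toggle_bad x)).
- by move=> G y; rewrite !inE => /negbTE ->; rewrite addbF.
- move=> G1 G2 y; rewrite !splitE !in_symdiff => /andP [h1 _] /andP [h2 _].
  rewrite inE => /eqP ->; rewrite in_toggle eqxx.
  by move: h1 h2; case: (x \in R); case: (x \in G1); case: (x \in G2).
- move=> c U cA0'; move: (cA0'); rewrite !inE => /andP [cx cA'].
  pose G := [set y | if y \in A then (y \in R) (+) (y == c) else y \in U].
  have GR y : y \in A -> (y \in symdiff G R) = (y == c).
    by move=> yA; rewrite in_symdiff inE yA addbC addbA addbb.
  exists G; split.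
  - rewrite splitE GR // eq_sym cx; apply/cards1P; exists c; apply/setP => y.
    rewrite in_setI in_setD1 in_set1; case: (boolP (y \in A)) => yA; last first.
      by rewrite !andbF; apply/esym/eqP => yc; rewrite yc cA' in yA.
    by rewrite GR // andbT; case: eqP => [->|]; rewrite ?cx.
  - by move=> y; rewrite -in_symdiff in_setD1 => /andP [_ /GR].
  by move=> y; rewrite !inE => h1 h2; rewrite h2 /= in h1; rewrite (negbTE h1).
- move=> H; exists R => //; rewrite -E.
  apply/esym/(compress_kept (toggleK x) (@toggle_bad x) (@toggle_fix x)) => G h1 h2.
  by apply: H; rewrite /split -E h1.
move=> H; exists (toggle x R).
  by apply/subsetP => y; rewrite inE; case: eqP => [->//|_]; rewrite addbF; apply: (subsetP RA).
apply/setP => G; rewrite (compress_moved (toggleK x) (@toggle_bad x) (@toggle_fix x)).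
  by rewrite -/(squash x F) E !in_ball symdiff_toggle symdiff_toggler.
by move=> U h1 h2; apply: H; rewrite /split -E h1.
Qed.

Lemma card_swap i j G : #|swap i j G| = #|G|.
Proof.
rewrite -[RHS](card_imset _ (@perm_inj _ (tperm i j))); apply: eq_card => y; rewrite inE.
by rewrite -{2}[y](tpermK i j) mem_imset //; apply: perm_inj.
Qed.

Lemma swapC i j G : swap i j G = swap j i G.
Proof. by rewrite /swap tpermC. Qed.

Lemma in_ball0 A G : (G \in ball A set0) = (#|G :&: A| <= 1).
Proof.
by rewrite inE; congr (#|pred_of_set (_ :&: _)| <= _); apply/setP => y; rewrite in_symdiff in_set0 addbF.
Qed.

Lemma swap_ball0 i j A G : (swap i j G \in ball A set0) = (G \in ball (swap i j A) set0).
Proof.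
rewrite !in_ball0 -(card_swap i j (swap i j G :&: A)); congr (#|pred_of_set _| <= _).
by apply/setP => y; rewrite !inE tpermK.
Qed.

(** Unless [A] is invariant, one of [i], [j] is some [p] in [A] and the other some [q] outside.
    Split sets contain [q], avoid [p] and have one element in [A :\ p], their label. If all were
    moved, [A] is replaced by its swap. *)
Lemma shift_ball i j F A k : 0 < k -> #|A| = k + 3 -> agreeing 3 k F ->
  shift i j F = ball A set0 -> exists2 A' : {set 'I_n}, #|A'| = #|A| & F = ball A' set0.
Proof.
move=> k0 cA H3 E.
have [sA|] := eqVneq (swap i j A) A.
  exists A => //; rewrite -E; apply/esym/(compress_kept (swapK i j) (@swap_bad i j) (@swap_fix i j)).
  by move=> G; rewrite -/(shift i j F) E swap_ball0 sA => ->.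
move=> sA.
have [p [q [pA qA es]]] : exists p q, [/\ p \in A, q \notin A & swap i j =1 swap p q].
  case: (boolP (i \in A)) => iA; case: (boolP (j \in A)) => jA.
  - by case/eqP: sA; apply: swap_fix; rewrite ?inE ?tpermL ?tpermR iA jA.
  - by exists i, j.
  - by exists j, i; split => // G; rewrite swapC.
  - by case/eqP: sA; apply: swap_fix; rewrite ?inE ?tpermL ?tpermR (negbTE iA) (negbTE jA).
have pq : p != q by apply: contraNneq qA => <-.
pose split G := (G \in ball A set0) && (swap i j G \notin ball A set0).
have splitE G : split G = [&& q \in G, p \notin G & #|G :&: (A :\ p)| == 1].
  rewrite /split swap_ball0 !in_ball0 es (cardsD1 p (G :&: A)) (cardsD1 q (G :&: swap p q A)).
  have -> : G :&: swap p q A :\ q = G :&: (A :\ p).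
    apply/setP => y; rewrite !inE; case: tpermP => [->|->|/eqP yp /eqP yq].
    - by rewrite eqxx (negbTE qA) !andbF.
    - by rewrite eqxx (negbTE qA) !andbF.
    - by rewrite yp yq.
  by rewrite setIDA !inE tpermR pA !andbT; case: (q \in G); case: (p \in G) => /=; lia.
have cA0 : #|A :\ p| = k + 2 by move: cA; rewrite (cardsD1 p) pA add1n addn3 addn2 => -[].
case: (@split_uniform _ (swap i j) F split (A :\ p) [set p; q] set0 k) => //.
- by rewrite cA0 addn2 addn3 !ltnS k0 /=.
- move=> y; rewrite !inE negb_or => /andP [-> yA].
  by apply: contraNneq qA => <-.
- move=> G; rewrite splitE => /and3P [_ _ /cards1P [a ea]]; exists a.
    by have := set11 a; rewrite -ea in_setI => /andP [].
  by move=> y yA; rewrite in_set0 addbF -[LHS]andbT -yA -in_setI ea inE.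
- by move=> G /andP []; rewrite -E; apply: (split_compress (swapK i j) (@swap_bad i j)).
- move=> G y; rewrite es !inE negb_or => /andP [yp yq].
  by rewrite tpermD // eq_sym.
- move=> G1 G2 y; rewrite !splitE es => /and3P [q1 p1 _] /and3P [q2 p2 _].
  rewrite !inE => /orP [] /eqP ->; rewrite ?tpermL ?tpermR ?q1 ?q2 //.
  by rewrite (negbTE p1).
- move=> c U; rewrite !inE => /andP [cp cA'].
  have cq : c != q by apply: contraNneq qA => <-.
  pose G := [set y | if y \in A :\ p then y == c else (y == q) || ((y != p) && (y \in U))].
  exists G; split.
  - rewrite splitE !inE !eqxx (negbTE qA) andbF (negbTE pq) /=.
    apply/cards1P; exists c; apply/setP => y; rewrite !inE.
    case: (boolP ((y != p) && (y \in A))) => h; first by rewrite andbT.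
    by rewrite andbF; apply/esym/eqP => yc; rewrite yc cp cA' in h.
  - by move=> y; rewrite !inE => ->; rewrite addbF.
  by move=> y; rewrite !inE negb_or => /negbTE -> /andP [-> /negbTE ->].
- move=> H; exists A => //; rewrite -E.
  apply/esym/(compress_kept (swapK i j) (@swap_bad i j) (@swap_fix i j)) => G h1 h2.
  by apply: H; rewrite /split -E h1.
move=> H; exists (swap i j A); first exact: card_swap.
apply/setP => G; rewrite (compress_moved (swapK i j) (@swap_bad i j) (@swap_fix i j)).
  by rewrite -/(shift i j F) E swap_ball0.
by move=> U h1 h2; apply: H; rewrite /split -E h1.
Qed.

End Operations.

(** * Extremal families *)

Section Extremal.

Variable n : nat.
Implicit Types (F : {set {set 'I_n}}) (G U A R : {set 'I_n}) (x y i j : 'I_n).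

(** Non-triviality provides, for a coordinate on which [s] sets agree, a member that breaks this
    agreement; so passing from [s + 1] down to [s] sets gains one coordinate. *)
Lemma nontrivial_agreeing r t F : 0 < t -> rwise_tagreeing r t F -> nontrivial F ->
  forall s, 1 < s <= r -> agreeing s (r + t - s) F.
Proof.
move=> t0 HF [F0 FT] s /andP [s1 sr]; have -> : r + t - s = t + (r - s) by lia.
have := erefl (r - s); move: {2}(r - s) => d; elim: d s s1 sr => [|d IH] s s1 sr ds.
  move=> Gs sGs aGs; have es : s = r by lia.
  rewrite ds addn0; have : forall i : 'I_r, nth set0 Gs i \in F.
    move=> i; apply: (allP aGs); apply: mem_nth; rewrite sGs es; exact: ltn_ord.
  move=> /HF h; apply: leq_trans h _; apply: subset_leq_card; apply/subsetP => y.
  rewrite !inE /agree_in => /orP [] /forallP H; apply/orP; [left|right].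
    apply/(all_nthP set0) => i; rewrite sGs es => ir; exact: (H (Ordinal ir)).
  apply/(all_nthP set0) => i; rewrite sGs es => ir; exact: (H (Ordinal ir)).
move=> Gs sGs aGs; have {}IH : agreeing s.+1 (t + d) F.
  have e : r - s.+1 = d by lia.
  by rewrite -e; apply: IH => //; lia.
rewrite ds addnS.
case: Gs sGs aGs => [|G0 Gs] sGs aGs; first by move: sGs => /= sGs; lia.
have h0 : t + d <= #|[set x | agree_in (G0 :: Gs) x]|.
  have -> : [set x | agree_in (G0 :: Gs) x] = [set x | agree_in (G0 :: G0 :: Gs) x].
    by apply/setP => y; rewrite !inE /agree_in /= !andbA !andbb.
  apply: IH; first by rewrite -sGs.
  by move: aGs => /= /andP [-> ->].
have [z] : exists z, z \in [set x | agree_in (G0 :: Gs) x].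
  by apply/card_gt0P; apply: leq_trans h0; rewrite ltn_addr.
rewrite inE => az.
have [G FG zG] : exists2 G, G \in F & (z \in G) != (z \in G0).
  case: (boolP (z \in G0)) => z0.
    apply/exists_inP; apply: contraT => /exists_inPn H.
    have : z \in \bigcap_(A in F) A by apply/bigcapP => A /H; case: (z \in A).
    by rewrite F0 inE.
  have : z \in \bigcup_(A in F) A by rewrite FT inE.
  by case/bigcupP => G FG zG; exists G; rewrite ?zG.
have h1 : t + d <= #|[set x | agree_in (G :: G0 :: Gs) x]|.
  by apply: IH; [rewrite -sGs | rewrite /= FG].
apply: leq_ltn_trans h1 _; apply: proper_card; apply/properP; split.
  apply/subsetP => y; rewrite !inE /agree_in /= => /orP [] /and3P [_ h2 h3]; rewrite h2 h3 ?orbT //.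
exists z; first by rewrite inE.
rewrite inE; apply/negP => az'; move: zG az'; rewrite /agree_in /=.
by case: (z \in G); case: (z \in G0).
Qed.

Lemma subclosed_sub F G U : subclosed F -> G \in F -> U \subset G -> U \in F.
Proof.
move=> dF; have [k] := ubnP #|G :\: U|; elim: k G => // k IH G lt GF UG.
have [/eqP e|/set0Pn [x]] := boolP (G :\: U == set0).
  suff -> : U = G by []; apply/eqP; rewrite eqEsubset UG.
  by rewrite -setD_eq0 e eqxx.
rewrite inE => /andP [xU xG]; apply: (IH (G :\ x)); last 1 first.
- by apply/subsetP => y yU; rewrite !inE (subsetP UG) // andbT; apply: contraNneq xU => <-.
- rewrite -ltnS; apply: leq_trans lt; rewrite ltnS; apply: proper_card; apply/properP; split.
    by apply: setSD; apply: subD1set.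
  by exists x; rewrite !inE ?xU ?xG ?eqxx.
- exact: dF.
Qed.

Lemma word_set_nth (w : seq bool) (i : 'I_n) b : size w = n -> forall y,
  (y \in word_set n (set_nth false w i b)) = if y == i then b else y \in word_set n w.
Proof. by move=> sw y; rewrite !inE nth_set_nth /= val_eqE. Qed.

Lemma word_family_shifted F : subclosed F -> (forall i j, i < j -> shift i j F = F) ->
  shifted n (word_family F).
Proof.
move=> dF sF; apply: stable_shifted.
- by move=> w /andP [/eqP].
- move=> w i /andP [/eqP sw wF] wi.
  have ni : i < n by rewrite -sw ltnNge; apply/negP => h; rewrite nth_default in wi.
  rewrite /word_family size_set_nth sw (maxn_idPr ni) eqxx /=.
  have -> : word_set n (set_nth false w i false) = word_set n w :\ Ordinal ni.
    apply/setP => y; rewrite (@word_set_nth w (Ordinal ni)) // in_setD1.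
    by case: (y == _).
  by apply: dF => //; rewrite inE.
move=> w i j /andP [/eqP sw wF] wi /andP [ij nj] wj.
have ni := ltn_trans ij nj.
rewrite /word_family !size_set_nth sw (maxn_idPr ni) (maxn_idPr nj) eqxx /=.
pose i' := Ordinal ni; pose j' := Ordinal nj.
have nij : (i' == j') = false by rewrite -val_eqE /= ltn_eqF.
have -> : word_set n (set_nth false (set_nth false w i false) j true) =
    swap i' j' (word_set n w).
  apply/setP => y; rewrite (@word_set_nth _ j'); last first.
    by rewrite size_set_nth sw (maxn_idPr ni).
  rewrite (@word_set_nth w i') // [RHS]inE; case: tpermP => [->|->|/eqP yi /eqP yj].
  - by rewrite nij eqxx inE (negbTE wj).
  - by rewrite eqxx inE wi.
  by rewrite (negbTE yi) (negbTE yj).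
have ij' : i' < j' by [].
have := sF i' j' ij' => /setP /(_ (word_set n w)).
by rewrite mem_shift wF !inE /= wi wj /= => ->.
Qed.

(** Deleting from the first set the intersection [I] of the others stays in the down-set and rules
    out common elements. What the sets then agree on are common zeros, also of the original first
    word. *)
Lemma word_family_graded r N F : subclosed F ->
  (forall s, 1 < s <= r -> agreeing s (N - s) F) -> graded r N n (word_family F).
Proof.
move=> dF H s sr [|w1 ws] sws; first by move: sr; rewrite -sws.
have nws : 0 < size ws by move: sr; rewrite -sws /= ltnS => /andP [].
move=> /= /andP [/andP [_ F1] aws].
pose I : {set 'I_n} := [set y : 'I_n | all (fun w => nth false w y) ws].
have h : N - s <= #|[set y | agree_in ((word_set n w1 :\: I) :: map (@word_set n) ws) y]|.
  apply: H => //; first by rewrite -sws /= size_map.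
  have mF : all (mem F) (map (@word_set n) ws).
    by rewrite all_map; apply/allP => w /(allP aws) /andP [].
  by apply/andP; split=> //; apply: subclosed_sub F1 _ => //; apply: subsetDl.
rewrite zerosE; apply: leq_trans h _; apply: subset_leq_card; apply/subsetP => y.
have e : (y \in I) = all (fun G => y \in G) (map (@word_set n) ws).
  by rewrite inE all_map; apply: eq_all => w; rewrite /= inE.
have e2 : all (fun w => ~~ nth false w y) ws =
    all (fun G => y \notin G) (map (@word_set n) ws).
  by rewrite all_map; apply: eq_all => w; rewrite /= inE.
move=> ay; rewrite in_set /= e2; move: ay; rewrite in_set /agree_in /= in_setD e.
have nws' : 0 < size (map (@word_set n) ws) by rewrite size_map.
rewrite in_set; move: nws'; case: (map _ _) => //= G Gs _.
by case: (y \in G); case: (nth false w1 y); case: (all _ Gs); case: (all _ Gs).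
Qed.

Lemma card_initial_ones N G : N <= n -> #|G :&: [set x : 'I_n | x < N]| = ones (set_word G) N.
Proof.
move=> Nn; rewrite /ones (big_ord_widen n (fun k : nat => nat_of_bool (nth false (set_word G) k))) //.
rewrite -sum1_card big_mkcond [RHS]big_mkcond; apply: eq_bigr => i _.
by rewrite !inE nth_set_word; case: (i \in G); case: (i < N).
Qed.

Lemma ones_mono w m k : m <= k -> ones w m <= ones w k.
Proof.
move=> /subnKC <-; elim: (k - m) => [|d IH]; first by rewrite addn0.
by rewrite addnS ones_recr (leq_trans IH) ?leq_addr.
Qed.

Lemma prefix_le_last_pair w N : 1 < N -> size w = n -> 1 < ones w N ->
  prefix_le (pair_word n (N - 2) (N - 1)) w.
Proof.
move=> N1 sw w2; split=> [|m]; first by rewrite size_pair_word.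
apply: leq_trans (ones_pair_word _ _ _ _) _.
have [Nm|mN] := leqP N m; first by have := ones_mono w Nm; do 2!case: (_ < _) => /=; lia.
have -> : (N - 1 < m) = false by lia.
case: (ltnP (N - 2) m) => // h; have em : N = m.+1 by lia.
by move: w2; rewrite em ones_recr; case: (nth _ _ _); lia.
Qed.

(** The size attains [graded_bound], so no word has two 1s among the first [N] letters; [F] lies in
    a ball of the same size. *)
Lemma stable_extremal r N F : 3 <= r -> r < N <= 2 ^ r - 2 ->
  (forall s, 1 < s <= r -> agreeing s (N - s) F) -> subclosed F ->
  (forall i j, i < j -> shift i j F = F) -> #|F| = N.+1 * 2 ^ (n - N) ->
  exists2 A : {set 'I_n}, #|A| = N & F = ball A set0.
Proof.
move=> r3 rN HF dF sF cF.
have gD := word_family_shifted dF sF; have gr := word_family_graded dF HF.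
have rN' : r <= N <= 2 ^ r - 2 by lia.
have [b strict] := graded_bound_all r3 gD gr rN'.
rewrite cnt_word_family cF -mulnA -expnD in b strict.
(* Subtraction is truncated, so [n - N + N] exceeds [n] unless [N <= n]; the bound excludes this. *)
have Nn : N <= n.
  by move: b; rewrite leq_pmul2l // leq_exp2l //; lia.
rewrite subnK // ltnn in strict.
have cA : #|[set x : 'I_n | x < N]| = N.
  rewrite -sum1_card (eq_bigl (fun i : 'I_n => i < N)); last by move=> i; rewrite inE.
  by rewrite -(big_ord_widen n (fun=> 1)) // sum1_card card_ord.
exists [set x : 'I_n | x < N] => //; apply/eqP; rewrite eqEcard; apply/andP; split.
  apply/subsetP => G GF; rewrite in_ball0 card_initial_ones //.
  rewrite leqNgt; apply/negP => h.
  have DG : word_family F (set_word G) by rewrite /word_family size_set_word eqxx set_wordK.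
  suff : false by []; apply: strict; first by lia.
  apply: (gD.2 _ _ _ DG); apply: prefix_le_last_pair => //; first by lia.
  exact: size_set_word.
rewrite cF -cnt_few1 subnKC // -cnt_word_family; apply: cnt_le => w sw.
rewrite /word_family => /andP [_]; rewrite in_ball0 card_initial_ones //.
by rewrite word_setK.
Qed.

(** Shift while this changes [F], which lowers the total weight, and undo each shift by
    [shift_ball]. *)
Lemma subclosed_extremal r N F : 3 <= r -> r < N <= 2 ^ r - 2 ->
  (forall s, 1 < s <= r -> agreeing s (N - s) F) -> subclosed F ->
  #|F| = N.+1 * 2 ^ (n - N) -> exists2 A : {set 'I_n}, #|A| = N & F = ball A set0.
Proof.
move=> r3 rN; have [k] := ubnP (total_weight F); elim: k F => // k IH F lt HF dF cF.
have [/existsP [i /existsP [j /andP [ij ne]]]|/existsPn st] :=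
  boolP [exists i : 'I_n, exists j : 'I_n, (i < j) && (shift i j F != F)].
  have nij : i != j by rewrite neq_ltn ij.
  have [||||A cA eA] := IH (shift i j F).
  - rewrite -ltnS; apply: leq_trans lt; rewrite ltnS.
    by apply: (total_weight_compress (swapK i j)) ne => G; apply: weight_swap.
  - by move=> s sr; apply: agreeing_shift => //; apply: HF.
  - exact: subclosed_shift.
  - by rewrite /shift (card_compress _ (swapK i j)).
  have [|||A' cA' eA'] := @shift_ball n i j F A (N - 3) _ _ _ eA; first by lia.
  - by rewrite cA subnK //; lia.
  - by apply: HF; lia.
  by exists A'; rewrite // cA'.
apply: (stable_extremal r3 rN HF dF) cF => i j ij; apply/eqP.
by have := st i; rewrite negb_exists => /forallP /(_ j); rewrite ij negbK.
Qed.

(** The same descent with down-compressions, undone by [squash_ball]; a family fixed by all of them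
    is a down-set. *)
Lemma agreeing_extremal r N F : 3 <= r -> r < N <= 2 ^ r - 2 ->
  (forall s, 1 < s <= r -> agreeing s (N - s) F) ->
  #|F| = N.+1 * 2 ^ (n - N) ->
  exists A R : {set 'I_n}, [/\ #|A| = N, R \subset A & F = ball A R].
Proof.
move=> r3 rN; have [k] := ubnP (total_weight F); elim: k F => // k IH F lt HF cF.
have [/existsP [x ne]|/existsPn st] := boolP [exists x, squash x F != F].
  have [|||A [R [cA RA eA]]] := IH (squash x F).
  - rewrite -ltnS; apply: leq_trans lt; rewrite ltnS.
    by apply: (total_weight_compress (toggleK x)) ne => G; apply: weight_toggle.
  - by move=> s sr; apply: agreeing_squash; apply: HF.
  - by rewrite /squash (card_compress _ (toggleK x)).
  have [|||R' RA' eR] := @squash_ball n x F A R (N - 3) _ _ RA _ eA; first by lia.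
  - by rewrite cA subnK //; lia.
  - by apply: HF; lia.
  by exists A, R'.
have dF : subclosed F.
  move=> G x GF xG; have := st x; rewrite negbK => /eqP e.
  have := GF; rewrite -{1}e (mem_compress (toggleK x) (@toggle_bad n x)) xG => /andP [_].
  suff -> : toggle x G = G :\ x by [].
  by apply/setP => y; rewrite !inE; case: eqP => [->|_]; rewrite ?xG ?addbF.
have [A cA eA] := subclosed_extremal r3 rN HF dF cF.
by exists A, set0; rewrite sub0set.
Qed.

End Extremal.

Theorem theorem3 (n r t : nat) (F : {set {set 'I_n}}) :
  3 <= r -> r < n -> 1 <= t -> t < 2 ^ r - r - 1 ->
  rwise_tagreeing r t F -> nontrivial F ->
  #|F| = (r + t + 1) * 2 ^ (n - r - t) ->
  exists A R : {set 'I_n},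
    [/\ #|A| = r + t, R \subset A &
        F = [set symdiff G R | G : {set 'I_n} & #|G :&: A| <= 1]].
Proof.
move=> r3 _ t1 tr HF nF cF.
have rN : r < r + t <= 2 ^ r - 2 by lia.
have cF' : #|F| = (r + t).+1 * 2 ^ (n - (r + t)) by rewrite cF addn1 subnDA.
have [A [R [cA RA eF]]] := agreeing_extremal r3 rN (nontrivial_agreeing t1 HF nF) cF'.
exists A, R; split=> //; rewrite eF.
have symdiffK : involutive (fun G : {set 'I_n} => symdiff G R).
  by move=> G; apply/setP => y; rewrite !in_symdiff -addbA addbb addbF.
apply/setP => G; rewrite in_ball; apply/idP/imsetP => [GA|[U UA ->]].
  by exists (symdiff G R); rewrite ?inE // symdiffK.
by rewrite symdiffK; move: UA; rewrite inE.
Qed.
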